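(* Consider the $GI^X/M/c/N$ queueing model with full rejection, with stationary pre-arrival probabilities $\pi(k)$ and batch-size tail $B^c(m)=\sum_{i=m}^{\infty}b(i)$. Then the time-average system size probabilities $p(n)$, $n=0,\dots,N$, are given by \[ p(n)=\frac{\lambda\sum_{k=0}^{n-1}\pi(k)\left[B^c(n-k)-B^c(N-k+1)\right]}{\min(n,c)\,\mu},\quad n=1,\dots,N;\qquad p(0)=1-\sum_{k=1}^{N}p(k). \]
   Context: The $GI^X/M/c/N$ model with full rejection: customers arrive in batches to a system with $c\ge 1$ parallel identical servers that can hold at most $N$ customers in total ($N\ge c$). The times between batch arrivals are i.i.d. with distribution function $A(t)$ and mean $1/\lambda$ (so $\lambda$ is the batch arrival rate); batch sizes are i.i.d. copies of $X$ with support in $\{1,2,\dots\}$ and $b(k)=P(X=k)$; service times are i.i.d. exponential with mean $1/\mu$; all are mutually independent. When $n$ customers are present the total service rate is $\min(n,c)\mu$. A batch that would bring the system state above $N$ is rejected in its entirety. $\pi(k)$ is the stationary (limiting) probability that an arriving batch finds $k$ customers in the system. With $X(t)$ the number of customers in the system at time $t$, $p(n)=\lim_{t\to\infty}P\{X(t)=n\}$ is the time-average stationary distribution; these stationary distributions are assumed to exist. *)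

(* Defs.v *)
From HB Require Import structures.
From mathcomp Require Import all_boot all_order all_algebra finmap.
From mathcomp Require Import all_classical all_reals all_analysis.

Set Implicit Arguments.
Unset Strict Implicit.
Unset Printing Implicit Defensive.

Import Order.TTheory GRing.Theory Num.Theory.
Import numFieldNormedType.Exports.

Local Open Scope classical_set_scope.
Local Open Scope ring_scope.

Section independence.
Context d (T : measurableType d) (R : realType) (P : probability T R).

Definition sigma_of d' (T' : measurableType d') (f : T -> T') : set (set T) :=
  preimage_set_system setT f measurable.

Definition mutually_independent (I : eqType) (F : I -> set (set T)) : Prop :=
  forall (s : seq I) (E : I -> set T), uniq s ->
    (forall i, i \in s -> F i (E i)) ->
    P (\bigcap_(i in [set` s]) E i) = (\prod_(i <- s) P (E i))%E.

End independence.

(* Labels of the primitive random variables of the queue.  Batches are numbered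
   from 0; [Service i r] is the service time of the r-th customer of batch i.
   The two [Initial] labels describe the customers present at time 0. *)
Inductive source :=
  | InitialSize
  | InitialService of nat
  | Interarrival of nat
  | BatchSize of nat
  | Service of nat & nat.

HB.instance Definition _ := gen_eqMixin source.

Section queue.
Context (R : realType) (T : Type).
(* [tau i] is the time between the arrivals of batches i-1 and i, and [tau 0] is
   the arrival time of batch 0. *)
Variables (c N : nat) (q0 : T -> nat) (s0 : nat -> T -> R).
Variables (tau : nat -> T -> R) (X : nat -> T -> nat) (S : nat -> nat -> T -> R).

Definition epoch (i : nat) (w : T) : R := \sum_(j < i.+1) tau j w.

(* Service is first come, first served (the discipline does not affect the law
   of the system size).
   [D] lists the departure times of the customers accepted so far.  A customer
   accepted at time [a] starts service as soon as at most c-1 of these are still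
   present, i.e. at the later of [a] and the c-th largest entry of [D]; at [a]
   if [D] has fewer than c entries. *)
Definition start_time (a : R) (D : seq R) : R :=
  Num.max a (nth a (sort >=%R D) c.-1).

Definition enqueue (a : R) (D : seq R) (services : seq R) : seq R :=
  foldl (fun D' x => rcons D' (start_time a D' + x)) D services.

Definition present (t : R) (D : seq R) : nat := count (fun e => t < e) D.

(* Departure times of the initial customers and of those accepted from the
   batches 0, ..., n-1. *)
Fixpoint departures (n : nat) (w : T) : seq R :=
  if n is i.+1 then
    let D := departures i w in
    if (present (epoch i w) D + X i w <= N)%N then
      enqueue (epoch i w) D [seq S i r w | r <- iota 0 (X i w)]
    else D
  else enqueue 0 [::] [seq s0 r w | r <- iota 0 (q0 w)].

Definition found (i : nat) (w : T) : nat :=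
  present (epoch i w) (departures i w).

(* [fset_set] of an infinite set is empty: this concerns only the null event
   that infinitely many batches arrive in [0, t]. *)
Definition arrivals (t : R) (w : T) : nat :=
  #|` fset_set [set i | epoch i w <= t] |.

Definition system_size (t : R) (w : T) : nat :=
  present t (departures (arrivals t w) w).

End queue.

Section primitives.
Context d (T : measurableType d) (R : realType).
Variables (q0 : T -> nat) (s0 : nat -> T -> R).
Variables (tau : nat -> T -> R) (X : nat -> T -> nat) (S : nat -> nat -> T -> R).

Definition primitives (j : source) : set (set T) :=
  match j with
  | InitialSize => sigma_of q0
  | InitialService r => sigma_of (s0 r)
  | Interarrival i => sigma_of (tau i)
  | BatchSize i => sigma_of (X i)
  | Service i r => sigma_of (S i r)
  end.

End primitives.

Definition batch_tail (R : realType) (b : nat -> R) (m : nat) : R :=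
  limn (fun M => \sum_(m <= i < M) b i).

(* Main.v *)
Require Import Defs.
From HB Require Import structures.
From mathcomp Require Import all_boot all_order all_algebra finmap.
From mathcomp Require Import all_classical all_reals all_analysis.
From mathcomp Require Import measurable_realfun.
From mathcomp Require Import zify ring lra.
Set Implicit Arguments.
Unset Strict Implicit.
Unset Printing Implicit Defensive.
Import Order.TTheory GRing.Theory Num.Theory.
Import numFieldNormedType.Exports.
Local Open Scope classical_set_scope.
Local Open Scope ring_scope.

(** Fix a level [n >= 1].  The moments when the number of customers goes from below
    [n] to at least [n] alternate with those when it goes back, so that upcrossings
    and downcrossings of [n] occur at the same long-run rate; the formula equates
    the two rates.

    An upcrossing occurs at an arrival: a batch that finds [k < n] customers
    causes one exactly when its size lies between [n - k] and [N - k], for a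
    smaller batch does not reach [n] and a larger one is rejected.  A batch is
    independent of what it finds, so the probability of an upcrossing at the
    [i]-th arrival is a combination of the [P (found i = k)]
    ([upcrossing_probability]), and converges.

    A downcrossing is a departure that leaves [n - 1] customers behind.  Each
    service time is an exponential clock: if [Z] has rate [mu] and is independent
    of [W], then for every measurable [G]
      [P ((Z, W) \in G) = mu * E (Lebesgue measure of {x in ]0, Z] | (x, W) \in G})]
    ([exponential_clock]).  Take for [Z] the service time of one customer, for [W]
    all the other primitives, and for [G] the event that, if his service lasts
    [x], he leaves [n - 1] customers behind between the arrivals [i] and [i + 1].
    As the history of the queue up to his departure does not depend on what comes
    after it ([held_set_service]), the right-hand side is [mu] times the expected
    time during which he is being served with [n] customers present.  Exactly
    [min(n, c)] customers are being served when [n] are present ([in_service]).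
    Summing over the customers, the probability of a downcrossing between two
    successive arrivals is [mu * min(n, c)] times the expected time spent at [n]
    between them ([downcrossing_rate]).

    Summing over the first [m] arrivals, [mu * min(n, c)] times the expected time
    spent at [n] before the [m]-th arrival is, up to an error of at most 1, the
    expected number of upcrossings.  The [m]-th arrival epoch is [m / lambda] up to
    an error that is [o(m)] in mean ([law_of_large_numbers_L1]), so this expected
    time is the integral of [P (system size at s = n)] over [s < m / lambda] up to
    [o(m)], hence [p n * m / lambda + o(m)] ([mean_occupation_cvg]).  Dividing by [m]
    gives the formula ([level_balance]).  The value of [p 0] follows because the
    system size never exceeds [N] ([system_size_mass]).

    The initial customers are treated as a batch number 0 arriving at time 0, so
    that every service time is indexed by a batch and a rank in it. *)

(** * Order statistics of departure times *)

Section departure_lists.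
Context {R : realType}.
Implicit Types (a s t theta : R) (D : seq R).

(** Left limit of [present]: the count taken when a customer leaves includes
    himself. *)
Definition held t D : nat := count (fun e => t <= e) D.

Lemma le_nth_sorted a s D k : sorted >=%R D -> (k < size D)%N ->
  (s <= nth a D k) = (k < held s D)%N.
Proof.
elim: D k => [//|x D IH] k /= xD kD; rewrite /held /=.
have /allP Dx : all (fun y => y <= x) D.
  by move: xD; rewrite (path_sortedE (rev_trans le_trans)) => /andP[].
case: k kD => [_|k kD] /=.
  case: (leP s x) => //= xs; rewrite add0n; apply/esym/negbTE; rewrite -leqNgt leqn0.
  by rewrite -leqn0 leqNgt -has_count; apply/hasPn => y /Dx yx; rewrite -ltNge (le_lt_trans yx).
rewrite (IH k (path_sorted xD) kD) /held.
case: (leP s x) => //= xs; rewrite add0n.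
have -> : count (fun e => s <= e) D = 0%N.
  apply/eqP; rewrite -leqn0 leqNgt -has_count; apply/hasPn => y /Dx yx.
  by rewrite -ltNge (le_lt_trans yx).
by [].
Qed.

(** The order statistic in [start_time] enters all later arguments through this
    characterization: at time [s] the newcomer is still waiting when at least [c]
    of the others are still present. *)
Lemma le_start_time (c : nat) a s D : (0 < c)%N ->
  (s <= start_time c a D) = (s <= a) || (c <= held s D)%N.
Proof.
move=> c0; rewrite /start_time le_max; case: (leP s a) => //= sa.
have [cD|Dc] := ltnP c.-1 (size D).
  rewrite le_nth_sorted ?size_sort//; last first.
    by apply: sort_sorted; exact: ge_total.
  by rewrite /held count_sort prednK.
rewrite nth_default ?size_sort// leNgt sa/=; apply/esym/negbTE.
rewrite -ltnNge; apply: leq_ltn_trans (count_size _ _) _.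
by rewrite (leq_ltn_trans Dc)// prednK.
Qed.

Lemma held_rcons t D x : held t (rcons D x) = (held t D + (t <= x)%R)%N.
Proof. by rewrite /held -cats1 count_cat /= addn0. Qed.

Lemma present_rcons t D x : present t (rcons D x) = (present t D + (t < x)%R)%N.
Proof. by rewrite /present -cats1 count_cat /= addn0. Qed.

(** No observation made before [theta] can tell the two lists apart.  Truncation
    at [theta] is monotone, so it is compatible with the order statistics that
    decide when services start. *)
Definition agree_below theta D D' :=
  map (Num.min theta) D = map (Num.min theta) D'.

Lemma agree_held theta t D D' : agree_below theta D D' -> t <= theta ->
  held t D = held t D'.
Proof.
move=> DD' tt.
have E L : held t L = held t (map (Num.min theta) L).
  by rewrite /held count_map; apply: eq_count => x /=; rewrite le_min tt.
by rewrite E DD' -E.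
Qed.

Lemma agree_present theta t D D' : agree_below theta D D' -> t < theta ->
  present t D = present t D'.
Proof.
move=> DD' tt.
have E L : present t L = present t (map (Num.min theta) L).
  by rewrite /present count_map; apply: eq_count => x /=; rewrite lt_min tt.
by rewrite E DD' -E.
Qed.

Lemma agree_start_time (c : nat) theta a D D' : (0 < c)%N -> agree_below theta D D' ->
  Num.min theta (start_time c a D) = Num.min theta (start_time c a D').
Proof.
move=> c0 DD'; have E s : s <= theta -> (s <= start_time c a D) = (s <= start_time c a D').
  by move=> st; rewrite !le_start_time// (agree_held DD' st).
apply/eqP; rewrite eq_le; apply/andP; split.
  rewrite le_min ge_min lexx /= -E ?ge_min ?lexx ?orbT//.
rewrite le_min ge_min lexx /= E ?ge_min ?lexx ?orbT//.
Qed.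

Lemma min_add_agree theta a a' x : 0 <= x ->
  Num.min theta a = Num.min theta a' -> Num.min theta (a + x) = Num.min theta (a' + x).
Proof.
move=> x0; rewrite !minElt; case: (ltP theta a); case: (ltP theta a');
  case: (ltP theta (a + x)); case: (ltP theta (a' + x)); lra.
Qed.

(** Between [u] and [v] the number of customers steps down through each of its
    values once, unless two customers leave together.  The entry with
    [held d D = n] is the [n]-th largest, and it lies in ]u, v] exactly when the
    count goes from at least [n] to less than [n]. *)
Lemma uniq_crossing D (u v : R) (n : nat) : uniq D -> u <= v ->
  (\sum_(d <- D) ((u < d <= v)%R && (held d D == n)))%N =
  ((present v D < n <= present u D)%N : nat).
Proof.
move=> uD uv.
(* Both sides depend on D up to permutation only; sort it in decreasing order. *)
have pD : perm_eq (rev (sort <=%R D)) D by rewrite perm_rev perm_sort.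
suff H L m : sorted >%R L -> 
  (\sum_(d <- L) ((u < d <= v)%R && (held d L == m)))%N =
  ((present v L < m <= present u L)%N : nat).
  rewrite -(perm_big _ pD) /= /present -!(permP pD) /= -H.
    by apply: eq_bigr => d _; rewrite /held (permP pD).
  by rewrite rev_sorted sort_lt_sorted.
elim: L m => [|x L IH] m xL; first by rewrite big_nil /present /= leqn0; case: m.
have sL : sorted >%R L := path_sorted xL.
have /allP Lx : all (fun y => y < x) L.
  by move: xL; rewrite /= (path_sortedE (rev_trans lt_trans)) => /andP[].
have zero t : x <= t -> present t L = 0%N.
  move=> xt; apply/eqP; rewrite -leqn0 leqNgt -has_count; apply/hasPn => y /Lx yx.
  by rewrite -leNgt (le_trans (ltW yx)).
have zeroh : held x L = 0%N.
  apply/eqP; rewrite -leqn0 leqNgt -has_count; apply/hasPn => y /Lx yx.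
  by rewrite -ltNge.
rewrite big_cons {1}/held /= lexx -/(held x L) zeroh addn0.
have -> : (\sum_(j <- L) ((u < j <= v)%R && (held j (x :: L) == m)) =
           if m is m'.+1 then \sum_(j <- L) ((u < j <= v)%R && (held j L == m')) else 0)%N.
  case: m => [|m]; rewrite ?big_seq ?[RHS]big_seq.
    by rewrite big1// => j jL; rewrite /held /= (ltW (Lx _ jL)) add1n andbF.
  by apply: eq_bigr => j jL; rewrite /held /= (ltW (Lx _ jL)) add1n eqSS.
case: m => [|m]; first by rewrite andbF.
rewrite IH// /present /= -!/(present _ _).
have [xu|ux] := leP x u; have [xv|vx] := leP x v => /=.
- by rewrite !zero//; lia.
- by exfalso; lra.
- by rewrite (zero v)//; case: m => [|m] /=; lia.
- by lia.
Qed.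

End departure_lists.

(** * The history of the queue along one path *)

Section path.
Context {R : realType}.
Variables (c N : nat) (e : nat -> R) (X : nat -> nat).
Implicit Types (sv : nat -> nat -> R) (L : seq (R * R)).

Definition ends L : seq R := map snd L.

Definition log_enqueue (a : R) L (xs : seq R) : seq (R * R) :=
  foldl (fun L x => let s := start_time c a (ends L) in rcons L (s, s + x)) L xs.

(** Besides the departure times, it records when the services start, which is
    what tells the customers being served from those waiting. *)
Fixpoint log sv m : seq (R * R) :=
  if m is i.+1 then
    let L := log sv i in
    if (present (e i) (ends L) + X i <= N)%N
    then log_enqueue (e i) L [seq sv i r | r <- iota 0 (X i)] else L
  else [::].

Definition before sv i r := log_enqueue (e i) (log sv i) [seq sv i k | k <- iota 0 r].
Definition admitted sv i := (present (e i) (ends (log sv i)) + X i <= N)%N.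
Definition start sv i r := start_time c (e i) (ends (before sv i r)).
Definition finish sv i r := start sv i r + sv i r.

Lemma ends_rcons L p : ends (rcons L p) = rcons (ends L) p.2.
Proof. by rewrite /ends map_rcons. Qed.

Lemma logS sv i :
  log sv i.+1 = if admitted sv i then before sv i (X i) else log sv i.
Proof. by []. Qed.

Lemma beforeS sv i r :
  before sv i r.+1 = rcons (before sv i r) (start sv i r, finish sv i r).
Proof.
by rewrite /before -addn1 iotaD map_cat /log_enqueue foldl_cat.
Qed.

Lemma ends_log_enqueue a L xs : ends (log_enqueue a L xs) = enqueue c a (ends L) xs.
Proof.
rewrite /log_enqueue /enqueue; elim: xs L => [|x xs IH] L //=.
by rewrite IH ends_rcons.
Qed.

Lemma log_ind sv m (Q : seq (R * R) -> Prop) : Q [::] ->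
  (forall i r, (i < m)%N -> Q (before sv i r) ->
     Q (rcons (before sv i r) (start sv i r, finish sv i r))) ->
  Q (log sv m).
Proof.
move=> Q0 QS; suff : forall i, (i <= m)%N -> Q (log sv i) by apply.
elim=> [|i IH] im //; rewrite logS; case: ifP => _; last exact/IH/ltnW.
elim: (X i) => [|r IHr]; first exact/IH/ltnW.
by rewrite beforeS; exact: QS.
Qed.

(** A batch that is admitted has at most [N] customers, so the labels
    [(i, r)] with [r < N] reach every entry of the log. *)
Lemma big_log (V : Type) (idx : V) (op : Monoid.com_law idx) sv m (F : R * R -> V) :
  \big[op/idx]_(p <- log sv m) F p =
  \big[op/idx]_(i < m) \big[op/idx]_(r < N)
    (if admitted sv i && (r < X i)%N then F (start sv i r, finish sv i r) else idx).
Proof.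
elim: m => [|m IH]; first by rewrite big_nil big_ord0.
rewrite big_ord_recr/= -IH -/(log sv m) -[LHS]/(\big[op/idx]_(p <- log sv m.+1) F p).
rewrite logS; case: (boolP (admitted sv m)) => adm /=; last by rewrite [X in op _ X]big1 ?Monoid.mulm1.
have XN : (X m <= N)%N by apply: leq_trans adm; exact: leq_addl.
have -> : \big[op/idx]_(r < N)
    (if (r < X m)%N then F (start sv m r, finish sv m r) else idx) =
    \big[op/idx]_(r < X m) F (start sv m r, finish sv m r).
  by rewrite -big_mkcond/= (big_ord_widen N (fun r => F (start sv m r, finish sv m r))).
elim: (X m) {adm XN} => [|r IHr]; first by rewrite big_ord0 Monoid.mulm1.
by rewrite beforeS big_rcons/= IHr big_ord_recr/= Monoid.mulmA.
Qed.

Lemma eq_log sv sv' m : (forall i r, (i < m)%N -> sv i r = sv' i r) ->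
  log sv m = log sv' m.
Proof.
elim: m => [|m IH] // E; have El : log sv m = log sv' m by apply: IH => i r im; apply: E; exact: ltnW.
rewrite !logS /admitted /before El; congr (if _ then log_enqueue _ _ _ else _).
by apply: eq_map => r; exact: E.
Qed.

Lemma eq_before sv sv' m r : (forall i k, (i < m)%N -> sv i k = sv' i k) ->
  (forall k, (k < r)%N -> sv m k = sv' m k) -> before sv m r = before sv' m r.
Proof.
move=> E1 E2; rewrite /before (eq_log E1); congr (log_enqueue _ _ _).
by apply/eq_in_map => k; rewrite mem_iota add0n => /E2.
Qed.

Hypothesis c0 : (0 < c)%N.

Lemma start_ge sv i r : e i <= start sv i r.
Proof. by rewrite /start le_start_time// lexx. Qed.

(** Changes that affect departures only from [theta] on do not propagate to times
    before [theta]: until then the same batches are admitted, and services that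
    start before [theta] start at the same time. *)
Lemma agree_log theta sv sv' m : (forall k, (k < m)%N -> e k < theta) ->
  (forall i r, (i < m)%N -> Num.min theta (start sv i r) = Num.min theta (start sv' i r) ->
     Num.min theta (finish sv i r) = Num.min theta (finish sv' i r)) ->
  agree_below theta (ends (log sv m)) (ends (log sv' m)).
Proof.
elim: m => [|m IH] // em H.
have AL : agree_below theta (ends (log sv m)) (ends (log sv' m)).
  by apply: IH => [k km|i r im]; [apply: em|apply: H]; exact: ltnW.
have -> : log sv m.+1 = if admitted sv' m then before sv m (X m) else log sv m.
  by rewrite logS /admitted (agree_present AL (em m (ltnSn m))).
rewrite logS; case: ifP => // _.
elim: (X m) => [|r IHr] //; rewrite !beforeS !ends_rcons /agree_below !map_rcons/=.
congr (rcons _ _); first exact: IHr.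
by apply: H => //; exact: agree_start_time.
Qed.

Definition set_service sv j k (x : R) : nat -> nat -> R :=
  fun i r => if (i == j) && (r == k) then x else sv i r.

Lemma before_set_service sv j k x : before (set_service sv j k x) j k = before sv j k.
Proof.
apply: eq_before => [i r ij|r rk]; rewrite /set_service.
  by rewrite (ltn_eqF ij).
by rewrite (ltn_eqF rk) andbF.
Qed.

Lemma start_set_service sv j k x : start (set_service sv j k x) j k = start sv j k.
Proof. by rewrite /start before_set_service. Qed.

Lemma finish_set_service sv j k x : finish (set_service sv j k x) j k = start sv j k + x.
Proof. by rewrite /finish start_set_service /set_service !eqxx. Qed.

Lemma admitted_set_service sv j k x :
  admitted (set_service sv j k x) j = admitted sv j.
Proof.
rewrite /admitted; congr (_ (ends _) + _ <= _)%N; apply: eq_log => i r ij.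
by rewrite /set_service (ltn_eqF ij).
Qed.

(** The queue observed when a customer leaves after a service of length [x] is the
    one that would be observed at that time had he needed longer. *)
Lemma held_set_service sv j k x m : (forall i r, 0 <= sv i r) -> x <= sv j k ->
  (forall i, (i < m)%N -> e i < start sv j k + x) ->
  held (start sv j k + x) (ends (log (set_service sv j k x) m)) =
  held (start sv j k + x) (ends (log sv m)).
Proof.
move=> sv0 xs em; apply: (@agree_held _ (start sv j k + x)) => //.
apply: agree_log => // i r im; have [[-> ->]|ij] := eqVneq (i, r) (j, k).
  rewrite finish_set_service => _; rewrite minxx /finish.
  by apply/esym/min_idPl; rewrite lerD2l.
rewrite /finish /set_service ifF; last by apply/negbTE; rewrite -xpair_eqE.
exact: min_add_agree.
Qed.

(** The departure of customer [k] of batch [j] occurs between the arrivals [i] and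
    [i + 1] and takes the number of customers from [n] to [n - 1]. *)
Definition departs_from n sv i j k :=
  [&& admitted sv j, (k < X j)%N, e i < finish sv j k <= e i.+1 &
      held (finish sv j k) (ends (log sv i.+1)) == n].

Lemma departs_from_set_service n sv i j k x : (forall i r, 0 <= sv i r) ->
  {homo e : i j / (i <= j)%N >-> i <= j} -> x <= sv j k ->
  departs_from n (set_service sv j k x) i j k =
  [&& admitted sv j, (k < X j)%N, e i < start sv j k + x <= e i.+1 &
      held (start sv j k + x) (ends (log sv i.+1)) == n].
Proof.
move=> sv0 eh xs; rewrite /departs_from finish_set_service admitted_set_service.
case: (boolP (e i < _ <= _)) => [/andP[ei _]|]; last by rewrite /= !andbF.
by rewrite held_set_service// => i' ii; rewrite (le_lt_trans _ ei)// eh.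
Qed.

(** Work conservation: the servers are all busy or nobody is waiting.  The number
    of waiting customers is the excess over [c] of the number present, because a
    newcomer waits at [s] exactly when [c] earlier customers are present at [s]. *)
Lemma in_service sv m s : (forall i r, 0 <= sv i r) -> (forall i, (i < m)%N -> e i < s) ->
  count (fun p => p.1 < s <= p.2) (log sv m) = minn c (held s (ends (log sv m))).
Proof.
move=> sv0 em.
(* Count the waiting customers, s <= p.1; those in service are the others. *)
suff : (all (fun p => p.1 <= p.2) (log sv m) &&
        (count (fun p => s <= p.1)%R (log sv m) == held s (ends (log sv m)) - c)%N).
  move=> /andP[/allP le12 /eqP E].
  have : (count (fun p => p.1 < s <= p.2)%R (log sv m) +
          count (fun p => s <= p.1)%R (log sv m) = held s (ends (log sv m)))%N.
    rewrite -count_predUI [X in (_ + X)%N](_ : _ = 0%N) ?addn0; last first.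
      rewrite (eq_count (a2 := pred0)) ?count_pred0// => p /=.
      by case: (ltP p.1 s); rewrite ?andbF.
    rewrite /held /ends count_map; apply: eq_in_count => p /le12 p12 /=.
    case: (ltP p.1 s) => //= sp; first by rewrite orbF.
    by rewrite (le_trans sp).
  by rewrite E; lia.
apply: (@log_ind sv m (fun L => all (fun p => p.1 <= p.2) L &&
        (count (fun p => s <= p.1)%R L == held s (ends L) - c)%N)) => [|i r im /andP[le12 /eqP E]]; first by rewrite /held /=.
rewrite all_rcons le12 /= lerDl sv0 /= ends_rcons held_rcons /=.
rewrite -cats1 count_cat /= addn0 E /finish /start le_start_time//.
rewrite leNgt (em i im) /=.
have [ch|hc] := leqP c (held s (ends (before sv i r))).
  have -> : s <= start_time c (e i) (ends (before sv i r)) + sv i r.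
    rewrite (@le_trans _ _ (start_time c (e i) (ends (before sv i r))))//.
      by rewrite le_start_time// ch orbT.
    by rewrite lerDl.
  by apply/eqP; lia.
by apply/eqP; case: (_ <= _) => /=; lia.
Qed.

Lemma uniq_ends_log sv m :
  (forall i r, finish sv i r \notin ends (before sv i r)) -> uniq (ends (log sv m)).
Proof.
move=> H; apply: (@log_ind sv m (fun L => uniq (ends L))) => // i r _ u.
by rewrite ends_rcons rcons_uniq u H.
Qed.

Lemma present_accept sv i : (forall r, 0 < sv i r) ->
  present (e i) (ends (log sv i.+1)) =
  (present (e i) (ends (log sv i)) + (if admitted sv i then X i else 0))%N.
Proof.
move=> sv0; rewrite logS; case: ifP => _; last by rewrite addn0.
elim: (X i) => [|r IH]; first by rewrite addn0.
rewrite beforeS ends_rcons present_rcons IH/= (_ : e i < finish sv i r) ?addn1 ?addnS//.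
by rewrite (le_lt_trans (start_ge sv i r))// ltrDl.
Qed.

(** Without ties, a downcrossing of [n] between two arrivals is the departure of
    exactly one customer. *)
Lemma departs_from_sum n sv i : uniq (ends (log sv i.+1)) -> e i <= e i.+1 ->
  (\sum_(j < i.+1) \sum_(k < N) departs_from n sv i j k)%N =
  ((present (e i.+1) (ends (log sv i.+1)) < n <= present (e i) (ends (log sv i.+1)))%N : nat).
Proof.
move=> u ei; rewrite -(uniq_crossing n u ei) {2}/ends big_map big_log/=.
apply: eq_bigr => j _; apply: eq_bigr => k _; rewrite /departs_from.
by case: (admitted sv j) => //=; case: ltnP.
Qed.

End path.

(** What a batch finds does not depend on its own size. *)
Lemma eq_log_batch (R : realType) (c N : nat) (e : nat -> R) (X X' : nat -> nat) sv m :
  (forall i, (i < m)%N -> X i = X' i) -> log c N e X sv m = log c N e X' sv m.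
Proof.
elim: m => [|m IH] // E; have El := IH (fun i im => E i (ltnW im)).
by rewrite !logS /admitted /before El E.
Qed.

Lemma present_anti (R : realType) (s t : R) D : s <= t -> (present t D <= present s D)%N.
Proof. by move=> st; apply: sub_count => x /=; exact: le_lt_trans. Qed.

(** * Independence of one primitive from all the others *)

Section independence_facts.
Context d (T : measurableType d) (R : realType) (P : probability T R).

(** A pi-lambda argument: [B |-> P (A `&` B)] and [B |-> P A * P B] are measures
    that agree on a class stable by intersection. *)
Lemma independent_generated (A : set T) (C : set (set T)) :
  measurable A -> setI_closed C -> C setT -> C `<=` measurable ->
  (forall B, C B -> P (A `&` B) = (P A * P B)%E) ->
  forall B, <<s C >> B -> P (A `&` B) = (P A * P B)%E.
Proof.
move=> mA CI CT Cm H B CB.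
have PA0 : 0 <= fine (P A) by exact: fine_ge0.
have PAK : ((fine (P A))%:E = P A)%E by rewrite fineK// fin_num_measure.
suff : mrestr P mA B = mscale (NngNum PA0) P B.
  by rewrite /mrestr /mscale/= PAK setIC.
apply: (g_sigma_algebra_measure_unique C Cm (fun=> setT)) => //.
- by rewrite bigcup_const//; exists 0%N.
- move=> B' CB'; transitivity (P (A `&` B')); first by rewrite setIC.
  by rewrite H// -{1}PAK.
- by move=> k; have : (P (setT `&` A) < +oo)%E by rewrite setTI ltey_eq fin_num_measure.
Qed.

Definition others (I : eqType) (F : I -> set (set T)) (j : I) : set (set T) :=
  \bigcup_(i in [set i | i != j]) F i.

(** The finite intersections of events of the other families form a class stable
    by intersection, on which the product rule is mutual independence. *)
Lemma mutually_independent_others (I : eqType) (F : I -> set (set T)) j A B :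
  mutually_independent P F ->
  (forall i, setI_closed (F i)) -> (forall i, F i setT) ->
  (forall i, F i `<=` measurable) ->
  F j A -> <<s others F j >> B -> P (A `&` B) = (P A * P B)%E.
Proof.
move=> indF FI FT Fm FA.
(* Two such intersections are merged over the union of their index sequences. *)
pose C : set (set T) := [set B | exists (s : seq I) (E : I -> set T),
  [/\ uniq s, j \notin s, (forall i, i \in s -> F i (E i)) &
      B = \bigcap_(i in [set` s]) E i]].
have CB : <<s others F j >> B -> <<s C >> B.
  apply: sub_sigma_algebra2 => D [i /= ij FD]; exists [:: i], (fun=> D); split => //.
  - by rewrite inE eq_sym.
  - by move=> k; rewrite inE => /eqP ->.
  - by apply/seteqP; split => [x Dx k _//|x /(_ i)]; rewrite /= inE; apply.
move=> /CB; apply: independent_generated.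
- exact: Fm FA.
- move=> _ _ [s1 [E1 [u1 j1 H1 ->]]] [s2 [E2 [u2 j2 H2 ->]]].
  exists (undup (s1 ++ s2)), (fun i => (if i \in s1 then E1 i else setT) `&`
      (if i \in s2 then E2 i else setT)); split.
  + exact: undup_uniq.
  + by rewrite mem_undup mem_cat negb_or j1.
  + by move=> i _; apply: FI; case: ifPn => // ?; [exact: H1|exact: H2].
  + apply/seteqP; split => x /=.
      by move=> [h1 h2] i /= _; split; case: ifP => // ?; [exact: h1|exact: h2].
    move=> h; split => i /= is_; have := h i; rewrite /= mem_undup mem_cat is_ ?orbT.
      by move=> /(_ isT)[].
    by move=> /(_ isT)[].
- exists [::], (fun=> setT); split => //; apply/seteqP; split => //.
- move=> _ [s [E [us js H ->]]]; apply: fin_bigcap_measurable => // i /= is_.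
  exact/Fm/H.
- move=> _ [s [E [us js H ->]]].
  pose E' i := if i == j then A else E i.
  have EE i : i \in s -> E' i = E i.
    by rewrite /E'; case: eqP => // -> ; rewrite (negbTE js).
  have /= := indF (j :: s) E'; rewrite js us => /(_ isT) h.
  have {h} : P (\bigcap_(i in [set` j :: s]) E' i) = (\prod_(i <- j :: s) P (E' i))%E.
    by apply: h => i; rewrite inE => /predU1P[->|is_]; [rewrite /E' eqxx|rewrite EE//; exact: H].
  rewrite big_cons {2}/E' eqxx [in X in (_ * X)%E]big_seq.
  under eq_bigr => i is_ do rewrite EE//.
  rewrite -big_seq -indF//.
  move=> <-; congr (P _); apply/seteqP; split => x.
    move=> [Ax h] i /=; rewrite inE => /predU1P[->|is_]; first by rewrite /E' eqxx.
    by rewrite EE//; exact: h.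
  move=> h; split; first by have := h j; rewrite /= mem_head /E' eqxx; exact.
  by move=> i /= is_; rewrite -EE//; apply: h; rewrite /= inE is_ orbT.
Qed.

End independence_facts.

(** * Integrating out an independent variable *)

Section decoupling.
Context d (T : measurableType d) (R : realType) (P : probability T R).
Context d1 (T1 : measurableType d1) d2 (T2 : measurableType d2).
Variables (Z : {RV P >-> T1}) (W : {RV P >-> T2}).
Hypothesis indep : forall A B, measurable A -> measurable B ->
  P (Z @^-1` A `&` W @^-1` B) = (P (Z @^-1` A) * P (W @^-1` B))%E.

Let pairZW (w : T) := (Z w, W w).

Let mpairZW : measurable_fun setT pairZW.
Proof. by apply: measurable_fun_pair. Qed.

HB.instance Definition _ := isMeasurableFun.Build _ _ _ _ pairZW mpairZW.

(** Independence says that the joint law is the product of the marginal laws on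
    rectangles, which determine it. *)
Lemma joint_law (G : set (T1 * T2)) : measurable G ->
  (distribution P Z \x distribution P W)%E G = distribution P pairZW G.
Proof.
by move=> mG; apply: product_measure_unique => // A B mA mB; exact: indep.
Qed.

Lemma integral_decouple (f : T1 * T2 -> \bar R) :
  measurable_fun [set: T1 * T2] f -> (forall z, 0 <= f z)%E ->
  (\int[P]_w f (Z w, W w) =
   \int[P]_w \int[distribution P Z]_x f (x, W w))%E.
Proof.
move=> mf f0.
rewrite -[LHS](@ge0_integral_distribution _ _ _ _ _ P pairZW f)//.
rewrite (eq_measure_integral (distribution P Z \x distribution P W)%E); last first.
  by move=> G mG _; exact/esym/joint_law.
rewrite fubini_tonelli2//.
rewrite (@ge0_integral_distribution _ _ _ _ _ P W)//.
  exact: (measurable_fun_fubini_tonelli_G f mf).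
by move=> y; apply: integral_ge0.
Qed.

Lemma probability_decouple (G : set (T1 * T2)) : measurable G ->
  (P [set w | G (Z w, W w)] = \int[P]_w distribution P Z [set x | G (x, W w)])%E.
Proof.
move=> mG.
have -> : P [set w | G (Z w, W w)] = (\int[P]_w (\1_G (Z w, W w))%:E)%E.
  transitivity (\int[P]_w (\1_(pairZW @^-1` G) w)%:E)%E; last first.
    by apply: eq_integral => w _; rewrite !indicE; congr (nat_of_bool _)%:R%:E; apply/idP/idP; rewrite !inE.
  by rewrite integral_indic ?setIT//; exact: measurable_funPTI.
rewrite (@integral_decouple (fun z => (\1_G z)%:E)); last 2 first.
- exact/measurable_EFinP/measurable_indic.
- by move=> z; rewrite lee_fin.
apply: eq_integral => w _.
transitivity (\int[distribution P Z]_x (\1_(ysection G (W w)) x)%:E)%E.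
  by apply: eq_integral => x _; rewrite !indicE mem_ysection.
rewrite integral_indic ?setIT//; last exact: measurable_ysection.
by congr (_ _); apply/seteqP; split => x; rewrite /ysection/= inE.
Qed.

End decoupling.

Section coarsening.
Context d (T : measurableType d) (G : set (set T)).
Hypothesis mG : G `<=` measurable.

(** The identity, seen as a random variable with values in [T] equipped with the
    coarser sigma-algebra generated by [G]: the information contained in [G]. *)
Definition coarsen (_ : G `<=` measurable) (w : T) : g_sigma_algebraType G := w.

Let measurable_coarsen : measurable_fun setT (coarsen mG).
Proof.
have h : <<s G >> `<=` measurable.
  by apply: smallest_sub => //; exact: sigma_algebra_measurable.
by move=> _ B mB; rewrite setTI; exact: h.
Qed.

HB.instance Definition _ :=
  isMeasurableFun.Build _ _ _ _ (coarsen mG) measurable_coarsen.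
End coarsening.

(** * Lebesgue measure and the exponential law *)

Section lebesgue_facts.
Context {R : realType}.
Notation leb := (@lebesgue_measure R).

(** Used to neglect the arrival and departure epochs themselves, at which left and
    right limits of the number of customers differ. *)
Lemma lebesgue_measure_eq_off (A B : set R) (s : seq R) :
  measurable A -> measurable B -> (forall x, x \notin s -> A x <-> B x) ->
  leb A = leb B.
Proof.
have H C D : measurable C -> measurable D -> (forall x, x \notin s -> C x -> D x) ->
    (leb C <= leb D)%E.
  move=> mC mD CD.
  have cs : countable [set` s] by exact/finite_set_countable/finite_seq.
  have ms : measurable [set` s] by exact: countable_measurable.
  rewrite -[leRHS](@measureU0 _ _ _ leb _ [set` s])//; last exact: countable_lebesgue_measure0.
  apply: le_measure; rewrite ?inE//; first exact: measurableU.
  by move=> x Cx; case: (boolP (x \in s)) => [|/CD CDx]; [right|left; exact: CDx].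
move=> mA mB AB; apply/eqP; rewrite eq_le; apply/andP.
by split; apply: H => // x /AB[].
Qed.

Let shift (a x : R) : measurableTypeR R := a + x.

Let mshift a : measurable_fun [set: measurableTypeR R] (shift a).
Proof. exact: measurable_funD. Qed.

HB.instance Definition _ a := isMeasurableFun.Build _ _ _ _ (shift a) (mshift a).

Lemma lebesgue_measure_shift (a : R) (A : set R) : measurable A ->
  leb [set x | A (a + x)] = leb A.
Proof.
move=> mA; rewrite -[LHS]/(pushforward leb (shift a) A).
apply/esym/lebesgue_measure_unique => //= _ [[u v]] _ <- /=.
rewrite /pushforward (_ : _ @^-1` _ = `]u - a, v - a]%classic); last first.
  by apply/seteqP; split => x; rewrite /= !in_itv/= ?/shift => /andP[? ?]; apply/andP; split; lra.
rewrite !lebesgue_measure_itv/= !lte_fin ltrD2r -!EFinD.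
by case: ifP => // _; congr (_%:E); lra.
Qed.

End lebesgue_facts.

Section exponential_law.
Context {R : realType} (mu : R) (mu0 : 0 < mu).
Variable law : probability R R.
Hypothesis lawE : forall B, measurable B -> law B = exponential_prob mu B.
Notation leb := (@lebesgue_measure R).

Let lawU0 (A B : set R) : measurable A -> measurable B -> law B = 0%E ->
  law (A `|` B) = law A.
Proof. by move=> mA mB B0; apply: measureU0. Qed.

Lemma exponential_law_set1 x : law [set x] = 0%E.
Proof. by rewrite lawE// /exponential_prob integral_set1. Qed.

Lemma exponential_law_le0 : law `]-oo, 0]%classic = 0%E.
Proof.
have -> : `]-oo, 0]%classic = `]-oo, (0:R)[%classic `|` [set 0].
  by rewrite setUitv1.
rewrite lawU0//; last exact: exponential_law_set1.
rewrite lawE// /exponential_prob; apply: integral0_eq => x /=; rewrite in_itv/= => x0.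
by rewrite lt0_exponential_pdf.
Qed.

Lemma exponential_law_ge x : 0 <= x -> law `[x, +oo[%classic = (expR (- mu * x))%:E.
Proof.
move=> x0.
have E : law `]-oo, x[%classic = (1 - expR (- mu * x))%:E.
  have -> : law `]-oo, x[%classic = law `]-oo, x]%classic.
    by rewrite -(@setUitv1 _ _ _ x true)// lawU0//; exact: exponential_law_set1.
  have [->|xn0] := eqVneq x 0; first by rewrite mulr0 expR0 subrr exponential_law_le0.
  have xp : 0 < x by rewrite lt_neqAle eq_sym xn0.
  rewrite EFinB -exponential_prob_itv0c// -lawE//.
  have -> : `]-oo, x]%classic = `[0, x]%classic `|` `]-oo, (0:R)]%classic.
    apply/seteqP; split => y /=; rewrite !in_itv/=.
      by move=> yx; case: (leP 0 y) => y0; [left; rewrite yx|right; exact: ltW].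
    by move=> [/andP[]//|y0]; exact: le_trans y0 x0.
  by rewrite lawU0//; exact: exponential_law_le0.
have -> : `[x, +oo[%classic = ~` `]-oo, x[%classic by rewrite setCitvl.
rewrite probability_setC// E -EFinB; congr (_%:E); lra.
Qed.

(** Both sides are the integral over [G] of the density [mu * exp (- mu * x)], as
    [exp (- mu * x)] is the probability of exceeding [x]. *)
Lemma exponential_lawE (G : set R) : measurable G ->
  law G = (mu%:E * \int[law]_y leb (G `&` `]0%R, y]%classic))%E.
Proof.
move=> mG.
(* Fubini on the region x <= y: integrating over y first gives the tail at x. *)
pose A : set (R * R) := [set z | [/\ G z.2, 0 <= z.2 & z.2 <= z.1]].
have mA : measurable A.
  have -> : A = (snd @^-1` (G `&` `[0, +oo[%classic)) `&` [set z | z.2 <= z.1].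
    apply/seteqP; split => -[x y]; rewrite /A/= in_itv/= andbT.
      by move=> [].
    by move=> [[]].
  apply: measurableI.
    by rewrite -[X in measurable X]setTI; apply: measurable_snd => //; exact: measurableI.
  by rewrite -[X in measurable X]setTI; apply: measurable_fun_le.
have -> : (\int[law]_y leb (G `&` `]0%R, y]%classic) =
    \int[law]_y \int[leb]_x (\1_A (y, x))%:E)%E.
  apply: eq_integral => y _.
  transitivity (\int[leb]_x (\1_(xsection A y) x)%:E)%E; last first.
    by apply: eq_integral => x _; rewrite !indicE mem_xsection.
  rewrite integral_indic ?setIT//; last exact: measurable_xsection.
  apply: (@lebesgue_measure_eq_off _ _ _ [:: 0]).
  - exact: measurableI.
  - exact: measurable_xsection.
  - move=> x; rewrite inE => x0; rewrite /xsection/= inE /A/= in_itv/=.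
    split; first by move=> [? /andP[/ltW ? ?]].
    by move=> [? ? ->]; split => //; rewrite lt_neqAle eq_sym x0 andbT.
have -> : (\int[law]_y \int[leb]_x (\1_A (y, x))%:E =
    \int[leb]_x \int[law]_y (\1_A (y, x))%:E)%E.
  refine (@fubini_tonelli _ _ _ _ R law leb (fun z => (\1_A z)%:E) _ _).
    exact/measurable_EFinP/measurable_indic.
  by move=> z; rewrite lee_fin.
rewrite -ge0_integralZl_EFin//=; last 3 first.
- by move=> x _; apply: integral_ge0 => y _; rewrite lee_fin.
- apply: (measurable_fun_fubini_tonelli_G (fun z => (\1_A z)%:E)).
    exact/measurable_EFinP/measurable_indic.
  by move=> z; rewrite lee_fin.
- exact: ltW.
rewrite lawE// /exponential_prob integral_mkcond; apply: eq_integral => x _.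
transitivity (mu%:E * \int[law]_y (\1_(ysection A x) y)%:E)%E; last first.
  by congr (_ * _)%E; apply: eq_integral => y _; rewrite !indicE mem_ysection.
rewrite integral_indic ?setIT//; last exact: measurable_ysection.
rewrite patchE; case: ifPn => [|/negP]; rewrite inE => xG; last first.
  rewrite (_ : ysection A x = set0) ?measure0 ?mule0//.
  by apply/seteqP; split => y //; rewrite /ysection/= inE => -[].
have [x0|x0] := leP 0 x; last first.
  rewrite lt0_exponential_pdf// (_ : ysection A x = set0) ?measure0 ?mule0//.
  by apply/seteqP; split => y //; rewrite /ysection/= inE => -[/=]; lra.
rewrite exponential_pdfE//= (_ : ysection A x = `[x, +oo[%classic) ?exponential_law_ge//.
apply/seteqP; split => y; rewrite /ysection/= inE in_itv/= andbT; first by case.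
by split.
Qed.

End exponential_law.

(** * The exponential clock *)

Lemma measurable_bool_set d (T : measurableType d) (b : T -> bool) :
  measurable_fun setT b -> measurable [set x | b x].
Proof. by move=> mb; rewrite -[X in measurable X]setTI; exact: (mb measurableT [set true]). Qed.

Section exponential_clock.
Context d (T : measurableType d) (R : realType) (P : probability T R).
Context d2 (T2 : measurableType d2).
Variables (Z : {RV P >-> R}) (W : {RV P >-> T2}) (mu : R).
Hypothesis mu0 : 0 < mu.
Hypothesis indep : forall A B, measurable A -> measurable B ->
  P (Z @^-1` A `&` W @^-1` B) = (P (Z @^-1` A) * P (W @^-1` B))%E.
Hypothesis lawZ : forall B, measurable B ->
  distribution P Z B = exponential_prob mu B.
Notation leb := (@lebesgue_measure R).

Lemma measurable_fun_clock (G : set (R * T2)) : measurable G ->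
  measurable_fun [set: R * T2]
    (fun z => leb [set x | 0 < x <= z.1 /\ G (x, z.2)]).
Proof.
move=> mG.
pose B : set ((R * T2) * R) := [set u | 0 < u.2 <= u.1.1 /\ G (u.2, u.1.2)].
have m2 : measurable_fun setT (fun u : (R * T2) * R => u.2) by exact: measurable_snd.
have m11 : measurable_fun setT (fun u : (R * T2) * R => u.1.1).
  by exact: measurableT_comp.
have m12 : measurable_fun setT (fun u : (R * T2) * R => u.1.2).
  by exact: measurableT_comp.
have mB : measurable B.
  have -> : B = [set u | 0 < u.2] `&` [set u | u.2 <= u.1.1] `&`
     ((fun u => (u.2, u.1.2)) @^-1` G).
    by apply/seteqP; split=> u; rewrite /B/=; [move=> [/andP[]]|move=> [[-> ->]]].
  apply: measurableI; first apply: measurableI.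
  - by apply: measurable_bool_set; exact: measurable_fun_ltr.
  - by rewrite -[X in measurable X]setTI; apply: measurable_fun_le.
  - rewrite -[X in measurable X]setTI.
    by apply: (measurable_fun_pair m2 m12).
rewrite (_ : (fun z => _) = leb \o xsection B).
  exact: measurable_fun_xsection.
apply/funext => z /=; congr (leb _).
by apply/seteqP; split=> x; rewrite /xsection/= inE.
Qed.

(** A clock that is still running rings at rate [mu], whatever the rest of the
    world does: the probability that it rings in a set of favourable instants is
    [mu] times the expected time spent running at favourable instants. *)
Lemma exponential_clock (G : set (R * T2)) : measurable G ->
  (P [set w | G (Z w, W w)] =
   mu%:E * \int[P]_w leb [set x | (0 < x <= Z w)%R /\ G (x, W w)])%E.
Proof.
move=> mG; rewrite (probability_decouple indep mG).
pose h (z : R * T2) := leb [set x | (0 < x <= z.1) /\ G (x, z.2)].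
have mh : measurable_fun [set: R * T2] h by exact: measurable_fun_clock.
have h0 z : (0 <= h z)%E by [].
rewrite -[in RHS]/(\int[P]_w h (Z w, W w))%E (integral_decouple indep mh h0).
rewrite -ge0_integralZl_EFin//=; last 3 first.
- by move=> w _; apply: integral_ge0.
- have mG0 : measurable_fun setT (fun v => \int[distribution P Z]_x h (x, v))%E.
    exact: measurable_fun_fubini_tonelli_G.
  rewrite [X in measurable_fun _ X](_ : _ = (fun v => \int[distribution P Z]_x h (x, v))%E \o W) //.
  by apply: measurableT_comp.
- exact: ltW.
apply: eq_integral => w _.
have mGw : measurable [set x | G (x, W w)].
  have -> : [set x | G (x, W w)] = ysection G (W w).
    by apply/seteqP; split=> x; rewrite /ysection/= inE.
  exact: measurable_ysection.
rewrite (exponential_lawE mu0 lawZ mGw); congr (_ * _)%E.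
apply: eq_integral => y _; rewrite /h/=; congr (leb _).
by apply/seteqP; split=> x; rewrite /= in_itv/= => -[].
Qed.

(** The expected time spent at finitely many instants is zero. *)
Lemma exponential_clock_atomless (G : set (R * T2)) (s : T -> seq R) : measurable G ->
  (forall w x, G (x, W w) -> x \in s w) -> P [set w | G (Z w, W w)] = 0%E.
Proof.
move=> mG Gs; rewrite exponential_clock// integral0_eq ?mule0// => w _.
rewrite (@lebesgue_measure_eq_off _ _ set0 (s w)) ?measure0//.
- rewrite (_ : [set x | _] = `]0, Z w]%classic `&` ysection G (W w)).
    by apply: measurableI => //; exact: measurable_ysection.
  by apply/seteqP; split => x; rewrite /ysection/= inE in_itv.
- by move=> x /negP xs; split => // -[_ /Gs].
Qed.

End exponential_clock.

(** * Measurability of the queue *)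

Section measurable_nat.
Context d (T : measurableType d).

Lemma measurable_fun_nat_case d' (T' : measurableType d')
    (f : nat -> T -> T') (K : T -> nat) :
  (forall k, measurable_fun setT (f k)) -> measurable_fun setT K ->
  measurable_fun setT (fun w => f (K w) w).
Proof.
move=> mf mK _ Y mY; rewrite setTI.
rewrite (_ : _ @^-1` Y = \bigcup_k ((K @^-1` [set k]) `&` (f k @^-1` Y))).
  apply: bigcupT_measurable => k; apply: measurableI.
    by rewrite -[X in measurable X]setTI; exact: mK.
  by rewrite -[X in measurable X]setTI; exact: mf.
apply/seteqP; split => w /=; first by exists (K w).
by move=> [k _ [/= ->]].
Qed.

Lemma measurable_fun_nat_op2 d' (T' : measurableType d') (op : nat -> nat -> T')
    (f g : T -> nat) :
  measurable_fun setT f -> measurable_fun setT g ->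
  measurable_fun setT (fun w => op (f w) (g w)).
Proof.
move=> mf mg; apply: (@measurable_fun_nat_case _ _ (fun k w => op k (g w))) => // k.
by apply: (measurableT_comp (f := op k)).
Qed.

Lemma measurable_fun_natP (f : T -> nat) :
  (forall k, measurable [set w | f w = k]) -> measurable_fun setT f.
Proof.
move=> mf _ Y mY; rewrite setTI.
rewrite (_ : f @^-1` Y = \bigcup_(k in Y) [set w | f w = k]).
  by apply: bigcup_measurable => k _.
apply/seteqP; split => w /=; first by move=> Yw; exists (f w).
by move=> [k Yk /= ->].
Qed.

Lemma measurable_nat_eq (f : T -> nat) k :
  measurable_fun setT f -> measurable [set w | f w = k].
Proof. by move=> mf; rewrite -[X in measurable X]setTI; exact: (mf measurableT [set k]). Qed.

End measurable_nat.

Section measurable_lists.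
Context d (T : measurableType d) (R : realType).
Implicit Types (D : T -> seq R).

(** Lists are only ever observed by counting the entries beyond a random
    threshold: measurability of these counts is what is meant here by
    measurability of a random list. *)
Definition measurable_list D := forall f : T -> R, measurable_fun setT f ->
  measurable_fun setT (fun w => held (f w) (D w)) /\
  measurable_fun setT (fun w => present (f w) (D w)).

Lemma measurable_list_nil : measurable_list (fun=> [::]).
Proof. by move=> f mf; split. Qed.

Lemma measurable_list_rcons D (x : T -> R) : measurable_list D ->
  measurable_fun setT x -> measurable_list (fun w => rcons (D w) (x w)).
Proof.
move=> mD mx f mf; have [mh mp] := mD f mf; split.
  rewrite (_ : (fun w => _) = fun w => (held (f w) (D w) + (f w <= x w)%R)%N); last first.
    by apply/funext => w; rewrite held_rcons.
  apply: (measurable_fun_nat_op2 (addn)) => //.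
  by apply: (measurableT_comp (f := nat_of_bool)) => //; exact: measurable_fun_ler.
rewrite (_ : (fun w => _) = fun w => (present (f w) (D w) + (f w < x w)%R)%N); last first.
  by apply/funext => w; rewrite present_rcons.
apply: (measurable_fun_nat_op2 (addn)) => //.
by apply: (measurableT_comp (f := nat_of_bool)) => //; exact: measurable_fun_ltr.
Qed.

Lemma measurable_list_case (D : nat -> T -> seq R) (K : T -> nat) :
  (forall k, measurable_list (D k)) -> measurable_fun setT K ->
  measurable_list (fun w => D (K w) w).
Proof.
move=> mD mK f mf; split.
  by apply: (measurable_fun_nat_case (f := fun k w => held (f w) (D k w))) => // k;
    exact: (mD k f mf).1.
by apply: (measurable_fun_nat_case (f := fun k w => present (f w) (D k w))) => // k;
  exact: (mD k f mf).2.
Qed.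

Lemma measurable_list_if D D' (b : T -> bool) : measurable_list D ->
  measurable_list D' -> measurable_fun setT b ->
  measurable_list (fun w => if b w then D w else D' w).
Proof.
move=> mD mD' mb f mf; have [h p] := mD f mf; have [h' p'] := mD' f mf.
split; under eq_fun do rewrite (fun_if (fun L => _ (f _) L)).
  exact: measurable_fun_ifT.
exact: measurable_fun_ifT.
Qed.

(** By [le_start_time], [start_time] is at least [s] when the arrival or a count is. *)
Lemma measurable_fun_start_time (c : nat) (a : T -> R) D : (0 < c)%N ->
  measurable_fun setT a -> measurable_list D ->
  measurable_fun setT (fun w => start_time c (a w) (D w)).
Proof.
move=> c0 ma mD; apply: (measurability _ (RGenCInfty.measurableE R)) => //.
move=> _ [_ [s ->] <-]; rewrite setTI.
rewrite (_ : _ @^-1` _ = [set w | (s <= a w) || (c <= held s (D w))%N]); last first.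
  by apply/seteqP; split => w; rewrite /= in_itv/= andbT le_start_time.
apply: measurable_bool_set; apply: measurable_or; first exact: measurable_fun_ler.
apply: (measurable_fun_nat_op2 (leq)) => //.
by have [] := mD (fun=> s) (measurable_cst _).
Qed.

Lemma held_present_mem t (L : seq R) : held t L = (present t L + count_mem t L)%N.
Proof.
elim: L => [|x L IH] //=; rewrite /held /present /= -/(held t L) -/(present t L) IH.
by rewrite le_eqVlt eq_sym; case: (ltgtP x t) => //=; lia.
Qed.

Lemma measurable_fun_mem (x : T -> R) D : measurable_fun setT x ->
  measurable_list D -> measurable_fun setT (fun w => x w \in D w).
Proof.
move=> mx mD; have [mh mp] := mD x mx.
rewrite (_ : (fun w => _) = fun w => (present (x w) (D w) < held (x w) (D w))%N).
  exact: measurable_fun_ltn.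
apply/funext => w; rewrite held_present_mem -[X in (X < _)%N]addn0 ltn_add2l.
by rewrite -has_count has_pred1.
Qed.

Lemma enqueue_rcons (c : nat) (a x : R) (D xs : seq R) :
  enqueue c a D (rcons xs x) =
  rcons (enqueue c a D xs) (start_time c a (enqueue c a D xs) + x).
Proof. by rewrite /enqueue foldl_rcons. Qed.

Lemma measurable_enqueue (c : nat) (a : T -> R) D (x : nat -> T -> R) k :
  (0 < c)%N -> measurable_fun setT a -> (forall r, measurable_fun setT (x r)) ->
  measurable_list D ->
  measurable_list (fun w => enqueue c (a w) (D w) [seq x r w | r <- iota 0 k]).
Proof.
move=> c0 ma mx mD; elim: k => [|k IH] //.
under eq_fun do rewrite -addn1 iotaD map_cat cats1 enqueue_rcons.
apply: measurable_list_rcons => //.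
by apply: measurable_funD => //; exact: measurable_fun_start_time.
Qed.

Section measurable_log.
Variables (c N : nat) (e : nat -> T -> R) (X : nat -> T -> nat).
Variable sv : nat -> nat -> T -> R.
Hypotheses (c0 : (0 < c)%N) (me : forall i, measurable_fun setT (e i))
  (mX : forall i, measurable_fun setT (X i))
  (msv : forall i r, measurable_fun setT (sv i r)).
Let lg i w := ends (log c N (e^~ w) (X^~ w) (fun i r => sv i r w) i).
Let bf i r w := ends (before c N (e^~ w) (X^~ w) (fun i r => sv i r w) i r).

Let measurable_before_of i : measurable_list (lg i) -> forall r, measurable_list (bf i r).
Proof.
move=> mL r; rewrite /bf; under eq_fun do rewrite ends_log_enqueue.
exact: measurable_enqueue.
Qed.

Lemma measurable_log i : measurable_list (lg i).
Proof.
elim: i => [|i IH]; first exact: measurable_list_nil.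
rewrite (_ : lg i.+1 = fun w => if (present (e i w) (lg i w) + X i w <= N)%N
    then bf i (X i w) w else lg i w); last first.
  by apply/funext => w; rewrite /lg logS /admitted; case: ifP.
apply: measurable_list_if => //.
  by apply: measurable_list_case => // k; exact: measurable_before_of.
apply: (measurable_fun_nat_op2 (fun a b => (a + b <= N)%N)) => //.
exact: (IH _ (me i)).2.
Qed.

Lemma measurable_before i r : measurable_list (bf i r).
Proof. exact/measurable_before_of/measurable_log. Qed.

Lemma measurable_start i r : measurable_fun setT
  (fun w => start c N (e^~ w) (X^~ w) (fun i r => sv i r w) i r).
Proof. exact: (measurable_fun_start_time c0 (me i) (measurable_before i r)). Qed.

Lemma measurable_finish i r : measurable_fun setT
  (fun w => finish c N (e^~ w) (X^~ w) (fun i r => sv i r w) i r).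
Proof. by apply: measurable_funD => //; exact: measurable_start. Qed.

Lemma measurable_admitted i : measurable_fun setT
  (fun w => admitted c N (e^~ w) (X^~ w) (fun i r => sv i r w) i).
Proof.
apply: (measurable_fun_nat_op2 (fun a b => (a + b <= N)%N)) => //.
exact: (measurable_log i (me i)).2.
Qed.

Lemma measurable_departs_from n i j k : measurable_fun setT
  (fun w => departs_from c N (e^~ w) (X^~ w) n (fun i r => sv i r w) i j k).
Proof.
rewrite /departs_from; have mf := measurable_finish j k.
apply: measurable_and; first exact: measurable_admitted.
apply: measurable_and; first exact: (measurable_fun_nat_op2 (fun a b => (a < b)%N)).
apply: measurable_and.
  by apply: measurable_and; [exact: measurable_fun_ltr|exact: measurable_fun_ler].
apply: (measurable_fun_nat_op2 (fun a b => a == b)) => //.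
exact: (measurable_log i.+1 mf).1.
Qed.

End measurable_log.

Lemma card_fset_set_bounded (p : pred nat) M : (forall i, p i -> (i < M)%N) ->
  #|` fset_set [set i | p i] | = count p (iota 0 M).
Proof.
move=> pM; rewrite (_ : [set i | p i] = [set` [fset i in seq.filter p (iota 0 M)]%fset]).
  by rewrite set_fsetK card_fseq undup_id ?filter_uniq ?iota_uniq// size_filter.
apply/seteqP; split => i /=; rewrite in_fset_ mem_filter mem_iota /= add0n; last by case/andP.
by move=> pi; rewrite pi pM.
Qed.

(** The finite sets are the ones bounded by some [M], and then the cardinal is a
    finite sum; [fset_set] of an infinite set is empty. *)
Lemma measurable_card_fset_set (p : nat -> T -> bool) :
  (forall i, measurable_fun setT (p i)) ->
  measurable_fun setT (fun w => #|` fset_set [set i | p i w] |).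
Proof.
move=> mp; apply: measurable_fun_natP => k.
(* B M is the event that the random set is bounded by M. *)
pose B M := \bigcap_(i in [set i | (M <= i)%N]) [set w | ~~ p i w].
have mB M : measurable (B M).
  apply: bigcap_measurableType => i _; apply: measurable_bool_set.
  exact: measurable_neg.
rewrite (_ : [set w | _] =
    (\bigcup_M (B M `&` [set w | (\sum_(i < M) p i w)%N == k])) `|`
    (if k == 0%N then ~` (\bigcup_M B M) else set0)).
  apply: measurableU.
    apply: bigcupT_measurable => M; apply: measurableI => //.
    apply: measurable_bool_set; apply: (measurableT_comp (f := fun a : nat => a == k)) => //.
    elim: M => [|M IH]; first by under eq_fun do rewrite big_ord0; exact: measurable_cst.
    under eq_fun do rewrite big_ord_recr/=.
    apply: (measurable_fun_nat_op2 (addn)) => //.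
    by apply: (measurableT_comp (f := nat_of_bool)).
  by case: ifP => _; [apply: measurableC; exact: bigcupT_measurable|].
have E w M : B M w -> #|` fset_set [set i | p i w] | = (\sum_(i < M) p i w)%N.
  move=> BM; rewrite (@card_fset_set_bounded _ M).
    rewrite -sum1_count big_mkcond -(big_mkord xpredT (fun i => nat_of_bool (p i w))).
    by rewrite /index_iota subn0; apply: eq_bigr => i _; case: (p i w).
  by move=> i pi; rewrite ltnNge; apply/negP => /BM /=; rewrite pi.
have E0 w : ~ (\bigcup_M B M) w -> #|` fset_set [set i | p i w] | = 0%N.
  move=> nB; rewrite (_ : fset_set _ = fset0) ?cardfs0//.
  rewrite /fset_set; case: pselect => // fin; exfalso; apply: nB.
  have [M HM] : exists M, forall i, p i w -> (i < M)%N.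
    move/finite_fsetP: fin => [F EF]; exists (\max_(i <- F) i).+1 => i pi.
    rewrite ltnS; apply: (leq_bigmax_seq (F := id)) => //.
    by have := pi; rewrite -[is_true (p i w)]/([set i | p i w] i) EF.
  by exists M => // i /= Mi; apply/negP => /HM; rewrite ltnNge Mi.
apply/seteqP; split => w /=.
  have [[M _ BM]|nB] := pselect ((\bigcup_M B M) w).
    by rewrite (E w M BM) => <-; left; exists M => //; split => /=.
  by rewrite E0// => <-; right; rewrite eqxx.
move=> [[M _ [BM /= /eqP <-]]|]; first exact: E.
by case: eqP => // -> nB; exact: E0.
Qed.

Section measurable_queue.
Variables (c N : nat) (q0 : T -> nat) (s0 : nat -> T -> R).
Variables (tau : nat -> T -> R) (X : nat -> T -> nat) (S : nat -> nat -> T -> R).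
Hypotheses (c0 : (0 < c)%N) (mq0 : measurable_fun setT q0)
  (ms0 : forall r, measurable_fun setT (s0 r))
  (mtau : forall i, measurable_fun setT (tau i))
  (mX : forall i, measurable_fun setT (X i))
  (mS : forall i r, measurable_fun setT (S i r)).

Let measurable_epoch i : measurable_fun setT (epoch tau i).
Proof. exact: measurable_sum. Qed.

Lemma measurable_departures m : measurable_list (departures c N q0 s0 tau X S m).
Proof.
elim: m => [|m IH].
  apply: (measurable_list_case (D := fun k w =>
    enqueue c 0 [::] [seq s0 r w | r <- iota 0 k])) => // k.
  apply: measurable_enqueue => //; exact: measurable_list_nil.
have me := measurable_epoch m; apply: measurable_list_if => //.
  apply: (measurable_list_case (D := fun k w => enqueue c (epoch tau m w)
    (departures c N q0 s0 tau X S m w) [seq S m r w | r <- iota 0 k])) => // k.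
  exact: measurable_enqueue.
apply: (measurable_fun_nat_op2 (fun x y => (x + y <= N)%N)) => //.
exact: (IH _ me).2.
Qed.

Lemma measurable_system_size (t : T -> R) : measurable_fun setT t ->
  measurable_fun setT (fun w => system_size c N q0 s0 tau X S (t w) w).
Proof.
move=> mt; apply: (measurable_fun_nat_case
  (f := fun k w => present (t w) (departures c N q0 s0 tau X S k w))) => [k|].
  exact: (measurable_departures k mt).2.
apply: (measurable_card_fset_set (p := fun i w => epoch tau i w <= t w)) => i.
exact: measurable_fun_ler.
Qed.

End measurable_queue.

End measurable_lists.

(** Lifting the primitives to a larger space, as required to regard the system size
    as a function of time and randomness jointly, commutes with the queue. *)
Lemma system_size_comp (R : realType) (T T' : Type) (f : T' -> T) (c N : nat)
    (q0 : T -> nat) (s0 tau : nat -> T -> R) (X : nat -> T -> nat)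
    (S : nat -> nat -> T -> R) t w :
  system_size c N (q0 \o f) (fun r => s0 r \o f) (fun i => tau i \o f)
    (fun i => X i \o f) (fun i r => S i r \o f) t w =
  system_size c N q0 s0 tau X S t (f w).
Proof.
rewrite /system_size; have -> n : departures c N (q0 \o f) (fun r => s0 r \o f)
    (fun i => tau i \o f) (fun i => X i \o f) (fun i r => S i r \o f) n w =
    departures c N q0 s0 tau X S n (f w).
  by elim: n => [|n IH] //=; rewrite IH.
by [].
Qed.

(** * Time at a level between two arrivals *)

Section window.
Context {R : realType}.
Notation leb := (@lebesgue_measure R).

Lemma measurable_list_cst d (T : measurableType d) (D : seq R) :
  measurable_list (fun _ : T => D).
Proof.
elim/last_ind: D => [|D x IH]; first exact: measurable_list_nil.
exact: (measurable_list_rcons IH (measurable_cst x)).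
Qed.

Variables (c N : nat) (e : nat -> R) (X : nat -> nat) (sv : nat -> nat -> R).
Hypotheses (c0 : (0 < c)%N) (eh : {homo e : i j / (i <= j)%N >-> i <= j})
  (sv0 : forall i r, 0 <= sv i r).

(** Along one path, add up over the customers the service time spent while [n]
    customers are present between the arrivals [i] and [i + 1].  At each such
    instant [minn n c] customers are in service. *)
Lemma window_time n i :
  (\sum_(j < i.+1) \sum_(k < N)
    leb [set x | (0 < x <= sv j k)%R /\
                 departs_from c N e X n (set_service sv j k x) i j k] =
  (minn n c)%:R%:E *
   leb [set s | (e i <= s < e i.+1)%R /\
                present s (ends (log c N e X sv i.+1)) = n])%E.
Proof.
set L := log c N e X sv i.+1; set D := ends L.
(* W is the set of instants at level n, up to finitely many of them. *)
pose W : set R := [set s | e i < s <= e i.+1 /\ held s D == n].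
have mheld : measurable_fun setT (fun s => held s D).
  exact: (@measurable_list_cst _ R D id (@measurable_id _ R setT)).1.
have mpres : measurable_fun setT (fun s => present s D).
  exact: (@measurable_list_cst _ R D id (@measurable_id _ R setT)).2.
have mW : measurable W.
  rewrite (_ : W = `]e i, e i.+1]%classic `&` [set s | held s D == n]).
    apply: measurableI => //; apply: measurable_bool_set.
    by apply: (measurableT_comp (f := fun a : nat => a == n)).
  by apply/seteqP; split => x; rewrite /= in_itv.
pose A (p : R * R) : set R := `]p.1, p.2]%classic `&` W.
have mA p : measurable (A p) by exact: measurableI.
have -> : leb [set s | e i <= s < e i.+1 /\ present s D = n] = leb W.
  apply: (@lebesgue_measure_eq_off _ _ _ (e i :: e i.+1 :: D)) => //.
    rewrite (_ : [set s | _] = `[e i, e i.+1[%classic `&` [set s | present s D == n]).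
      apply: measurableI => //; apply: measurable_bool_set.
      by apply: (measurableT_comp (f := fun a : nat => a == n)).
    by apply/seteqP; split => x; rewrite /= in_itv /= => -[-> /eqP].
  move=> s; rewrite !inE !negb_or => /and3P[s1 s2 sD]; rewrite /W /=.
  have -> : held s D = present s D.
    by rewrite held_present_mem -[RHS]addn0; congr addn; apply/count_memPn.
  rewrite [e i <= s]le_eqVlt eq_sym (negbTE s1) /=.
  rewrite [s <= _]le_eqVlt (negbTE s2) /=; split => -[-> h]; split => //.
    exact/eqP.
  exact/eqP.
(* The age x of a service becomes the instant s = start + x. *)
transitivity (\sum_(p <- L) leb (A p))%E.
  rewrite (big_log c N e X _ sv i.+1 (fun p => leb (A p))).
  apply: eq_bigr => j _; apply: eq_bigr => k _.
  under [in LHS]eq_set => x.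
    rewrite (_ : (_ /\ _) = (0 < x <= sv j k /\ 
       [&& admitted c N e X sv j, (k < X j)%N, e i < start c N e X sv j k + x <= e i.+1 &
      held (start c N e X sv j k + x) D == n])); last first.
      apply/propext; split => -[/[dup] x0 /andP[_ xs]];
        by rewrite departs_from_set_service.
    over.
  case: (admitted c N e X sv j) => /=; last first.
    by rewrite (_ : [set x | _] = set0) ?measure0//; apply/seteqP; split => x //= [].
  case: ltnP => _ /=; last first.
    by rewrite (_ : [set x | _] = set0) ?measure0//; apply/seteqP; split => x //= [].
  rewrite -(lebesgue_measure_shift (start c N e X sv j k) (mA _)).
  congr (leb _); apply/seteqP; split => x; rewrite /A /W /= in_itv/=.
    move=> [x0 /andP[h1 h2]]; split => //; move: x0; rewrite /finish ltrDl lerD2l//.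
  by move=> [x0 [-> ->]]; split => //; move: x0; rewrite /finish ltrDl lerD2l.
(* The integrand counts the customers in service at the instant s of W. *)
transitivity (\int[leb]_s (\sum_(p <- L) (\1_(A p) s)%:E))%E.
  rewrite ge0_integral_sum//; last first.
    by move=> p; apply/measurable_EFinP; apply: measurable_indic; exact: mA.
  by apply: eq_bigr => p _; rewrite integral_indic ?setIT//; exact: mA.
rewrite -[X in (_ * leb X)%E]setIT -integral_indic// -ge0_integralZl_EFin//; last first.
  by apply/measurable_EFinP; exact: measurable_indic.
apply: eq_integral => s _; rewrite sumEFin -EFinM; congr (_%:E).
rewrite [in RHS]indicE; have [sW|sW] := boolP (s \in W); last first.
  rewrite mulr0 big1// => p _; rewrite indicE; case: (boolP (s \in A p)) => //.
  by rewrite inE => -[_]; rewrite -in_setE (negbTE sW).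
rewrite mulr1; have [es /eqP hn] := set_mem sW.
rewrite minnC -{1}hn -(in_service (m := i.+1) N X c0 sv0); last first.
  by move=> i' ii; rewrite (le_lt_trans _ (proj1 (andP es)))// eh.
rewrite -sum1_count natr_sum [RHS]big_mkcond/=; apply: eq_bigr => p _.
rewrite indicE /A in_setI sW andbT.
have -> : (s \in `]p.1, p.2]%classic) = (p.1 < s <= p.2).
  by apply/idP/idP; rewrite inE/= in_itv.
by case: (_ < _ <= _).
Qed.

End window.

(** * The rate of downcrossings *)

Lemma measurable_lebesgue_section (R : realType) d (T : measurableType d)
    (b : R * T -> bool) : measurable_fun [set: R * T] b ->
  measurable_fun [set: T] (fun w => lebesgue_measure [set s | b (s, w)]).
Proof.
move=> mb; have mB := measurable_bool_set mb.
rewrite (_ : (fun w => _) = lebesgue_measure \o ysection [set z | b z]).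
  exact: (measurable_fun_ysection lebesgue_measure mB).
apply/funext => w /=; congr (lebesgue_measure _).
by apply/seteqP; split => x; rewrite /ysection/= inE.
Qed.

Lemma probability_bool (R : realType) d (T : measurableType d) (P : probability T R)
    (b : T -> bool) : measurable_fun setT b ->
  P [set w | b w] = (\int[P]_w (b w)%:R%:E)%E.
Proof.
move=> mb; rewrite -[LHS]/(P [set w | b w]) -[X in P X]setIT.
rewrite -integral_indic//; last exact: measurable_bool_set.
apply: eq_integral => w _; rewrite indicE; congr (nat_of_bool _)%:R%:E.
by apply/idP/idP; rewrite inE.
Qed.

Lemma measurable_fun_of_bool (R : realType) d (T : measurableType d) (b : T -> bool) :
  measurable_fun setT b -> measurable_fun setT (fun w => (b w)%:R : R).
Proof. by move=> mb; apply: (measurableT_comp (f := fun a : bool => a%:R : R)). Qed.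

Lemma ge0_integral_sum2 (R : realType) d (T : measurableType d)
    (P : {measure set T -> \bar R}) (f : nat -> nat -> T -> \bar R) m n :
  (forall j k, measurable_fun setT (f j k)) -> (forall j k w, 0 <= f j k w)%E ->
  (\int[P]_w \sum_(j < m) \sum_(k < n) f j k w =
   \sum_(j < m) \sum_(k < n) \int[P]_w f j k w)%E.
Proof.
move=> mf f0; rewrite ge0_integral_sum//.
- by apply: eq_bigr => j _; rewrite ge0_integral_sum.
- by move=> j; exact: emeasurable_sum.
- by move=> j w _; exact: sume_ge0.
Qed.

(** The queue with abstract arrival epochs and batch sizes, in which the service
    time of customer [k] of batch [j] is a clock independent of the information
    [G j k] that determines the arrivals, the batches and all other services. *)
Section clocked_queue.
Context d (T : measurableType d) (R : realType) (P : probability T R).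
Variables (c N : nat) (mu : R) (e : nat -> T -> R) (X : nat -> T -> nat).
Variables (sv : nat -> nat -> {RV P >-> R}) (G : nat -> nat -> set (set T)).
Hypotheses (c0 : (0 < c)%N) (mu0 : 0 < mu).
Hypotheses (me : forall i, measurable_fun setT (e i))
  (mX : forall i, measurable_fun setT (X i)).
Hypothesis mG : forall j k, G j k `<=` measurable.
Hypotheses
  (meG : forall j k i, measurable_fun [set: g_sigma_algebraType (G j k)] (e i))
  (mXG : forall j k i, measurable_fun [set: g_sigma_algebraType (G j k)] (X i))
  (msvG : forall j k i r, (i == j) && (r == k) = false ->
     measurable_fun [set: g_sigma_algebraType (G j k)] (sv i r)).
Hypothesis indep : forall j k A B, measurable A -> <<s G j k >> B ->
  P (sv j k @^-1` A `&` B) = (P (sv j k @^-1` A) * P B)%E.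
Hypothesis law : forall j k B, measurable B ->
  distribution P (sv j k) B = exponential_prob mu B.
Hypothesis eh : {ae P, forall w, {homo e^~ w : i j / (i <= j)%N >-> i <= j}}.

Let svw w i r := sv i r w.

Lemma service_gt0 : {ae P, forall w i r, 0 < sv i r w}.
Proof.
apply/ae_foralln => i; apply/ae_foralln => r.
exists (sv i r @^-1` `]-oo, 0]); split.
- exact: measurable_funPTI.
- exact: (exponential_law_le0 (law i r)).
- by move=> w /= /negP; rewrite -leNgt in_itv.
Qed.

Section clock.
Variables j k : nat.
Let Tjk := g_sigma_algebraType (G j k).
Notation idjk := (coarsen (@mG j k)).

Let idjk_indep A (B : set Tjk) : measurable A -> measurable B ->
  P (sv j k @^-1` A `&` idjk @^-1` B) = (P (sv j k @^-1` A) * P (idjk @^-1` B))%E.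
Proof. exact: indep. Qed.

Let sv' i r (z : R * Tjk) := if (i == j) && (r == k) then z.1 else sv i r z.2.

Let msv' i r : measurable_fun [set: R * Tjk] (sv' i r).
Proof.
rewrite /sv'; case: (boolP (_ && _)) => [_|/negbTE ij]; first exact: measurable_fst.
by apply: measurableT_comp => //; exact: msvG.
Qed.

Let me' i : measurable_fun [set: R * Tjk] (fun z => e i z.2).
Proof. by apply: measurableT_comp => //; exact: meG. Qed.

Let mX' i : measurable_fun [set: R * Tjk] (fun z => X i z.2).
Proof. by apply: measurableT_comp => //; exact: mXG. Qed.

Lemma set_serviceK w : set_service (svw w) j k (sv j k w) = svw w.
Proof.
apply/funext => i; apply/funext => r; rewrite /set_service /svw.
by case: ifP => // /andP[/eqP -> /eqP ->].
Qed.

Lemma departs_from_clock n i :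
  (P [set w | departs_from c N (e^~ w) (X^~ w) n (svw w) i j k] =
   mu%:E * \int[P]_w lebesgue_measure [set x | (0 < x <= sv j k w)%R /\
     departs_from c N (e^~ w) (X^~ w) n (set_service (svw w) j k x) i j k])%E.
Proof.
pose A : set (R * Tjk) := [set z |
  departs_from c N (e^~ z.2) (X^~ z.2) n (set_service (svw z.2) j k z.1) i j k].
have mA : measurable A.
  have h := measurable_departs_from N c0 me' mX' msv' n i j k.
  exact: (measurable_bool_set h).
rewrite -(@exponential_clock _ _ _ P _ _ (sv j k) idjk mu mu0 idjk_indep (law j k) _ mA).
by congr (P _); apply/seteqP; split => w; rewrite /A/= set_serviceK.
Qed.

Lemma measurable_departs_from_clock n i : measurable_fun [set: T] (fun w =>
  lebesgue_measure [set x | (0 < x <= sv j k w)%R /\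
     departs_from c N (e^~ w) (X^~ w) n (set_service (svw w) j k x) i j k]).
Proof.
pose A : set (R * Tjk) := [set z |
  departs_from c N (e^~ z.2) (X^~ z.2) n (set_service (svw z.2) j k z.1) i j k].
have mA : measurable A.
  have h := measurable_departs_from N c0 me' mX' msv' n i j k.
  exact: (measurable_bool_set h).
have h := measurable_fun_clock mA.
have m2 : measurable_fun setT (fun w => (sv j k w, idjk w)).
  exact: measurable_fun_pair.
exact: (measurableT_comp h m2).
Qed.

(** Given the other primitives, the departure time is a continuous random variable
    and almost surely avoids the finitely many departure times of the earlier
    customers. *)
Lemma finish_notin : {ae P, forall w,
  finish c N (e^~ w) (X^~ w) (svw w) j k \notin
  ends (before c N (e^~ w) (X^~ w) (svw w) j k)}.
Proof.
pose A : set (R * Tjk) := [set z |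
  finish c N (e^~ z.2) (X^~ z.2) (set_service (svw z.2) j k z.1) j k \in
  ends (before c N (e^~ z.2) (X^~ z.2) (set_service (svw z.2) j k z.1) j k)].
have mA : measurable A.
  apply: measurable_bool_set; apply: measurable_fun_mem.
    exact: (measurable_finish N c0 me' mX' msv' j k).
  exact: (measurable_before N c0 me' mX' msv' j k).
exists [set w | A (sv j k w, idjk w)]; split.
- rewrite (_ : [set w | _] = (fun w => (sv j k w, idjk w)) @^-1` A)//.
  rewrite -[X in measurable X]setTI.
  by apply: (measurable_fun_pair (measurable_funP _) (measurable_funP idjk)).
- apply: (@exponential_clock_atomless _ _ _ P _ _ (sv j k) idjk mu mu0 idjk_indep (law j k) _
    (fun w => [seq u - start c N (e^~ w) (X^~ w) (svw w) j k
                   | u <- ends (before c N (e^~ w) (X^~ w) (svw w) j k)]) mA).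
  move=> w x; rewrite /A/= finish_set_service before_set_service => h.
  by apply/mapP; exists (start c N (e^~ w) (X^~ w) (svw w) j k + x) => //; lra.
- by move=> w /= /negP; rewrite negbK /A/= set_serviceK.
Qed.

End clock.

Lemma uniq_ends : {ae P, forall w m,
  uniq (ends (log c N (e^~ w) (X^~ w) (svw w) m))}.
Proof.
have h : {ae P, forall w j k, finish c N (e^~ w) (X^~ w) (svw w) j k \notin
    ends (before c N (e^~ w) (X^~ w) (svw w) j k)}.
  by apply/ae_foralln => j; apply/ae_foralln => k; exact: finish_notin.
by apply: filterS h => w h m; exact: uniq_ends_log.
Qed.

Lemma measurable_ends m :
  measurable_list (fun w => ends (log c N (e^~ w) (X^~ w) (svw w) m)).
Proof. by apply: (@measurable_log _ _ _ c N e X sv) => // i r. Qed.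

Lemma measurable_window n i : measurable_fun [set: R * T] (fun z =>
  (e i z.2 <= z.1 < e i.+1 z.2) &&
  (present z.1 (ends (log c N (e^~ z.2) (X^~ z.2) (svw z.2) i.+1)) == n)).
Proof.
have me2 j : measurable_fun [set: R * T] (fun z => e j z.2).
  by apply: measurableT_comp.
have mX2 j : measurable_fun [set: R * T] (fun z => X j z.2).
  by apply: measurableT_comp.
have msv2 j k : measurable_fun [set: R * T] (fun z => sv j k z.2).
  by apply: measurableT_comp.
apply: measurable_and; first apply: measurable_and.
- exact: measurable_fun_ler.
- exact: measurable_fun_ltr.
- apply: (measurableT_comp (f := fun a : nat => a == n)) => //.
  exact: (measurable_log N c0 me2 mX2 msv2 i.+1 measurable_fst).2.
Qed.

(** Add up [departs_from_clock] over the customers.  The left-hand sides add up to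
    the probability of a downcrossing by [departs_from_sum], the right-hand sides
    to the time at level [n] by [window_time]. *)
Lemma downcrossing_rate n i :
  (P [set w | let D := ends (log c N (e^~ w) (X^~ w) (svw w) i.+1) in
       (present (e i.+1 w) D < n <= present (e i w) D)%N] =
   (mu * (minn n c)%:R)%:E * \int[P]_w lebesgue_measure
     [set s | (e i w <= s < e i.+1 w)%R /\
        present s (ends (log c N (e^~ w) (X^~ w) (svw w) i.+1)) = n])%E.
Proof.
pose h j k w := lebesgue_measure [set x | (0 < x <= sv j k w)%R /\
     departs_from c N (e^~ w) (X^~ w) n (set_service (svw w) j k x) i j k].
have mdf j k : measurable_fun setT (fun w =>
    departs_from c N (e^~ w) (X^~ w) n (svw w) i j k).
  by apply: (@measurable_departs_from _ _ _ c N e X sv).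
have mD t : measurable_fun setT t -> measurable_fun setT (fun w =>
    present (t w) (ends (log c N (e^~ w) (X^~ w) (svw w) i.+1))).
  by move=> mt; exact: (measurable_ends i.+1 mt).2.
have mwin : measurable_fun setT (fun w => lebesgue_measure
     [set s | (e i w <= s < e i.+1 w)%R /\
        present s (ends (log c N (e^~ w) (X^~ w) (svw w) i.+1)) = n]).
  have := measurable_lebesgue_section (measurable_window n i).
  congr measurable_fun; apply/funext => w; congr (lebesgue_measure _).
  by apply/seteqP; split => s /= => [/andP[-> /eqP]//|[-> ->]]; rewrite eqxx.
transitivity (\sum_(j < i.+1) \sum_(k < N)
    P [set w | departs_from c N (e^~ w) (X^~ w) n (svw w) i j k])%E.
  under eq_bigr => j _ do under eq_bigr => k _ do rewrite probability_bool//.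
  rewrite -(@ge0_integral_sum2 R _ _ P
    (fun j k w => (departs_from c N (e^~ w) (X^~ w) n (svw w) i j k)%:R%:E)); last 2 first.
  - by move=> j k; exact/measurable_EFinP/measurable_fun_of_bool.
  - by move=> j k w; rewrite lee_fin ler0n.
  rewrite probability_bool; last first.
    apply: measurable_and.
      by apply: (measurable_fun_nat_op2 (fun a b => (a < b)%N)) => //; exact: mD.
    by apply: (measurable_fun_nat_op2 (fun a b => (a <= b)%N)) => //; exact: mD.
  apply: ge0_ae_eq_integral => //.
  - apply/measurable_EFinP/measurable_fun_of_bool; apply: measurable_and.
      by apply: (measurable_fun_nat_op2 (fun a b => (a < b)%N)) => //; exact: mD.
    by apply: (measurable_fun_nat_op2 (fun a b => (a <= b)%N)) => //; exact: mD.
  - apply: emeasurable_sum => j; apply: emeasurable_sum => k.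
    exact/measurable_EFinP/measurable_fun_of_bool.
  - by move=> w _; apply: sume_ge0 => j _; apply: sume_ge0 => k _; rewrite lee_fin ler0n.
  apply: filterS2 uniq_ends eh => w uw ew _.
  rewrite -(departs_from_sum n (uw i.+1) (ew i i.+1 (leqnSn i))).
  rewrite natr_sum -sumEFin; apply: eq_bigr => j _.
  by rewrite natr_sum -sumEFin.
transitivity (\sum_(j < i.+1) \sum_(k < N) (mu%:E * \int[P]_w h j k w))%E.
  by apply: eq_bigr => j _; apply: eq_bigr => k _; exact: departs_from_clock.
have mh j k : measurable_fun setT (h j k) by exact: measurable_departs_from_clock.
transitivity (mu%:E * \sum_(j < i.+1) \sum_(k < N) (\int[P]_w h j k w))%E.
  rewrite ge0_sume_distrr; last first.
    by move=> j _; apply: sume_ge0 => k _; exact: integral_ge0.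
  apply: eq_bigr => j _; rewrite ge0_sume_distrr// => k _.
  exact: integral_ge0.
rewrite -ge0_integral_sum2//.
rewrite EFinM -muleA; congr (_ * _)%E.
rewrite -ge0_integralZl_EFin//.
apply: ge0_ae_eq_integral => //.
- by apply: emeasurable_sum => j; apply: emeasurable_sum => k.
- exact: measurable_funeM.
- by move=> w _; apply: sume_ge0 => j _; apply: sume_ge0 => k _.
- by move=> w _; rewrite mule_ge0.
apply: filterS2 service_gt0 eh => w sw ew _.
by apply: window_time => // j k; exact/ltW/sw.
Qed.

End clocked_queue.

(** * The law of large numbers in mean *)

(** The half-lines [`]x, +oo[] are stable by intersection and generate the Borel
    sets. *)
Lemma eq_cdf_distribution (R : realType) d (T : measurableType d) (P : probability T R)
    (Y Y' : {RV P >-> R}) : (forall t, cdf Y t = cdf Y' t) ->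
  forall B, measurable B -> distribution P Y B = distribution P Y' B.
Proof.
move=> YY' B mB.
have E x : distribution P Y `]x, +oo[%classic = distribution P Y' `]x, +oo[%classic.
  have -> : `]x, +oo[%classic = ~` `]-oo, x]%classic by rewrite setCitvl.
  by rewrite !probability_setC//; congr (_ - _)%E; exact: YY'.
apply: (measure_unique (@RGenOInfty.G R) (fun n => `]- (n%:R), +oo[%classic)) => //.
- exact: RGenOInfty.measurableE.
- move=> _ _ [x ->] [y ->]; exists (Num.max x y).
  by apply/seteqP; split => z /=; rewrite !in_itv/= !andbT gt_max => /andP.
- by move=> n; exists (- n%:R).
- apply/seteqP; split => // x _; exists (Num.bound `|x|) => //=.
  rewrite in_itv/= andbT ltrNl; apply: le_lt_trans (archi_boundP (normr_ge0 x)).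
  by rewrite (le_trans (ler_norm _))// normrN.
- by move=> _ [x ->]; exact: E.
- by move=> k; rewrite -ge0_fin_numE// fin_num_measure.
Qed.

Section truncation.
Context {R : realType}.
(** Truncation at 0 as well as at [K] makes the bound hold everywhere, and changes
    a nonnegative variable only where it exceeds [K]. *)
Definition truncate (K x : R) : R := Num.max 0 (Num.min K x).

Lemma truncate_ge0 K x : 0 <= truncate K x.
Proof. by rewrite /truncate le_max lexx. Qed.

Lemma truncate_le K x : 0 <= K -> truncate K x <= K.
Proof. by move=> K0; rewrite /truncate ge_max K0 ge_min lexx. Qed.

Lemma measurable_truncate K : measurable_fun setT (truncate K).
Proof.
by apply: measurable_maxr; [exact: measurable_cst|apply: measurable_minr; [exact: measurable_cst|exact: measurable_id]].
Qed.

Lemma truncate_id K x : 0 <= x <= K -> truncate K x = x.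
Proof.
by move=> /andP[x0 xK]; rewrite /truncate (min_idPr xK) (max_idPr x0).
Qed.

Lemma dist_truncate_le K x : 0 <= K -> `|x - truncate K x| <= `|x|.
Proof.
move=> K0; rewrite /truncate maxElt minElt.
case: (ltP K x) => ?; case: ifP => ?; rewrite ?subr0 ?subrr ?normr0//.
by rewrite !ger0_norm; lra.
Qed.
End truncation.

(** Independence is required of [tau n] and an information [G n] that determines the
    other variables. *)
Section law_of_large_numbers.
Context d (T : measurableType d) (R : realType) (P : probability T R).
Variables (tau : nat -> {RV P >-> R}) (m : R) (G : nat -> set (set T)).
Hypothesis mG : forall n, G n `<=` measurable.
Hypothesis mtauG : forall n i, i != n ->
  measurable_fun [set: g_sigma_algebraType (G n)] (tau i).
Hypothesis indep : forall n A B, measurable A -> <<s G n >> B ->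
  P (tau n @^-1` A `&` B) = (P (tau n @^-1` A) * P B)%E.
Hypothesis law_tau : forall n B, measurable B ->
  distribution P (tau n) B = distribution P (tau 0%N) B.
Hypothesis tau_ge0 : forall n, {ae P, forall w, 0 <= tau n w}.
Hypothesis tau_mean : ('E_P[tau 0%N] = m%:E)%E.

Let law := distribution P (tau 0%N).

Let integral_tau (f : R -> \bar R) n : measurable_fun setT f ->
  (forall x, 0 <= f x)%E -> (\int[P]_w f (tau n w) = \int[law]_x f x)%E.
Proof.
move=> mf f0; rewrite -[LHS](ge0_integral_distribution (P := P) (tau n) mf f0).
by apply: eq_measure_integral => A mA _; exact: law_tau.
Qed.

Let mean_abs : (\int[P]_w `|(tau 0%N w)%:E| = m%:E)%E.
Proof.
rewrite -tau_mean expectation_def; apply: ae_eq_integral => //.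
- by apply: measurableT_comp => //; exact/measurable_EFinP.
- exact/measurable_EFinP.
- apply: filterS (tau_ge0 0%N) => w h _ /=.
  by rewrite ger0_norm.
Qed.

Let integrable_tau : P.-integrable setT (EFin \o tau 0%N).
Proof. by apply/integrableP; split; [exact/measurable_EFinP|rewrite mean_abs ltry]. Qed.

Let tail K := (\int[law]_x (`|x - truncate K x|)%:E)%E.

Let mtail K : measurable_fun [set: R] (fun x : R => `|x - truncate K x|).
Proof.
apply: measurableT_comp => //; apply: measurable_funB => //.
exact: measurable_truncate.
Qed.

(** Dominated convergence, as the truncation at [K] tends to the identity. *)
Let tail_small (eps : R) : 0 < eps -> exists2 K, 0 <= K & (tail K <= eps%:E)%E.
Proof.
move=> eps0.
pose f n w : \bar R := (`|tau 0%N w - truncate n%:R (tau 0%N w)|)%:E.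
have [] := @dominated_convergence _ _ _ P setT measurableT f (cst 0%E)
  (fun w => `|(tau 0%N w)%:E|%E).
- move=> n; apply/measurable_EFinP.
  exact: (measurableT_comp (mtail n%:R) (measurable_funP (tau 0%N))).
- exact: measurable_cst.
- apply: filterS (tau_ge0 0%N) => w tw _.
  apply: cvg_near_cst; near=> n; rewrite /f truncate_id ?subrr ?normr0//.
  rewrite tw/=; near: n; exact: nbhs_infty_ger.
- exact: integrable_abse.
- apply/aeW => w n _; rewrite /f /= normr_id lee_fin.
  exact: dist_truncate_le.
move=> _ _; rewrite integral0 => /fine_cvgP[fin cv].
move/cvgrPdist_le: cv => /(_ eps eps0) h.
have [n _ /(_ n (leqnn n))[fn hn]] : \forall n \near \oo,
    (\int[P]_w f n w)%E \is a fin_num /\ `|0 - fine (\int[P]_w f n w)%E| <= eps.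
  by near=> n; split; near: n.
exists n%:R => //.
have E : (tail n%:R = \int[P]_w f n w)%E.
  rewrite /tail -(@integral_tau (fun x => (`|x - truncate n%:R x|)%:E) 0%N)//.
  by apply/measurable_EFinP; exact: mtail.
rewrite E -(fineK fn) lee_fin (le_trans _ hn)// sub0r normrN ler_norm//.
Unshelve. all: by end_near.
Qed.

Section truncated.
Variables (K : R) (K0 : 0 <= K).
Let y := fine (\int[law]_x (truncate K x)%:E)%E.

Let mtr : measurable_fun [set: R] (fun x : R => (truncate K x)%:E).
Proof. by apply/measurable_EFinP; exact: measurable_truncate. Qed.

Let mean_truncate_le : (\int[law]_x (truncate K x)%:E <= K%:E)%E.
Proof.
rewrite -[leRHS]mule1 -(probability_setT law) -integral_cst//.
apply: ge0_le_integral => //= x _; rewrite lee_fin ?truncate_ge0//.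
exact: truncate_le.
Qed.

Let yE : (\int[law]_x (truncate K x)%:E = y%:E)%E.
Proof.
rewrite /y fineK// ge0_fin_numE ?(le_lt_trans mean_truncate_le) ?ltry//.
by apply: integral_ge0 => x _; rewrite lee_fin truncate_ge0.
Qed.

Let y_ge0 : 0 <= y.
Proof. by apply: fine_ge0; apply: integral_ge0 => x _; rewrite lee_fin truncate_ge0. Qed.

Let y_le : y <= K.
Proof. by rewrite -lee_fin -yE. Qed.

(** The variance of a variable with values in [0, K] is at most [K ^+ 2], and its
    centred version is orthogonal to constants. *)
Let mean_square (a : R) :
  (\int[law]_x ((a + (truncate K x - y)) ^+ 2)%:E <= (a ^+ 2 + K ^+ 2)%:E)%E.
Proof.
have itr : law.-integrable setT (EFin \o truncate K).
  apply: measurable_bounded_integrable => //.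
  - by rewrite [X in (X < _)%E]probability_setT ltry.
  - exact: measurable_truncate.
  - exists K; split; first exact: num_real.
    move=> M KM x _ /=; rewrite ger0_norm ?truncate_ge0//.
    by rewrite (le_trans (truncate_le _ K0))// ltW.
apply: (@le_trans _ _ (\int[law]_x ((a ^+ 2 + K ^+ 2 - 2 * a * y)%:E + (2 * a)%:E * (truncate K x)%:E))%E).
  apply: ge0_le_integral => //.
  - by move=> x _; rewrite lee_fin sqr_ge0.
  - apply/measurable_EFinP; apply: measurable_funX; apply: measurable_funD => //.
    by apply: measurable_funB => //; exact: measurable_truncate.
  - by apply: emeasurable_funD => //; exact: measurable_funeM.
  - move=> x _; rewrite -EFinM -EFinD lee_fin.
    have := truncate_ge0 K x; have := truncate_le x K0; move: (truncate K x) => t.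
    move: y y_ge0 y_le => y' *.
    suff : (t - y') ^+ 2 <= K ^+ 2 by rewrite !expr2; lra.
    by rewrite -ler_sqrt ?sqr_ge0// !sqrtr_sqr (ger0_norm K0) ler_norml; lra.
rewrite integralD//; last 2 first.
- exact: finite_measure_integrable_cst.
- exact: integrableZl.
rewrite integral_cst// [X in (_ * X + _)%E]probability_setT mule1 integralZl// yE -EFinM -EFinD lee_fin.
lra.
Qed.

Let W n w := \sum_(i < n) (truncate K (tau i w) - y).

Let mW n : measurable_fun setT (W n).
Proof.
apply: measurable_sum => i; apply: measurable_funB => //.
by apply: measurableT_comp => //; exact: measurable_truncate.
Qed.

(** Each step adds at most [K ^+ 2], by integrating out the last variable with the
    partial sum of the others held fixed. *)
Lemma truncated_variance n : (\int[P]_w (W n w ^+ 2)%:E <= (n%:R * K ^+ 2)%:E)%E.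
Proof.
elim: n => [|n IH].
  by rewrite integral0_eq ?mul0r// => w _; rewrite /W big_ord0 expr0n.
pose f (z : R * g_sigma_algebraType (G n)) : \bar R :=
  ((W n z.2 + (truncate K z.1 - y)) ^+ 2)%:E.
have mf : measurable_fun [set: R * g_sigma_algebraType (G n)] f.
  apply/measurable_EFinP; apply: measurable_funX; apply: measurable_funD; last first.
    apply: measurable_funB => //.
    by apply: measurableT_comp measurable_fst; exact: measurable_truncate.
  have mWn : measurable_fun [set: g_sigma_algebraType (G n)] (W n).
    apply: measurable_sum => i; apply: measurable_funB => //.
    apply: measurableT_comp; first exact: measurable_truncate.
    by apply: mtauG; rewrite (ltn_eqF (ltn_ord i)).
  exact: (measurableT_comp mWn measurable_snd).
have -> : (\int[P]_w (W n.+1 w ^+ 2)%:E = \int[P]_w f (tau n w, coarsen (@mG n) w))%E.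
  by apply: eq_integral => w _; rewrite /W big_ord_recr.
rewrite (@integral_decouple _ _ _ P _ _ _ _ (tau n) (coarsen (@mG n)))//; last 2 first.
- by move=> A B mA mB; exact: indep.
- by move=> z; rewrite lee_fin sqr_ge0.
apply: (@le_trans _ _ (\int[P]_w ((W n w ^+ 2)%:E + (K ^+ 2)%:E))%E).
  apply: ge0_le_integral => //.
  - by move=> w _; apply: integral_ge0 => x _; rewrite lee_fin sqr_ge0.
  - have mG0 : measurable_fun setT (fun v => \int[distribution P (tau n)]_x f (x, v))%E.
      apply: measurable_fun_fubini_tonelli_G => //.
      by move=> z; rewrite lee_fin sqr_ge0.
    by apply: (measurableT_comp mG0).
  - by apply: emeasurable_funD => //; apply/measurable_EFinP; exact: measurable_funX.
  - move=> w _; rewrite -EFinD (eq_measure_integral law); last first.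
      by move=> A mA _; exact: law_tau.
    exact: (mean_square (W n w)).
rewrite ge0_integralD//; last 3 first.
- by move=> w _; rewrite lee_fin sqr_ge0.
- by apply/measurable_EFinP; exact: measurable_funX.
- by move=> w _; rewrite lee_fin sqr_ge0.
rewrite integral_cst// [X in (_ * X)%E]probability_setT mule1.
by rewrite -natr1 mulrDl mul1r EFinD leeD2r.
Qed.

(** From [v <= a + v ^+ 2 / a], which holds whether [v] is below or above [a]. *)
Lemma truncated_lln n (a : R) : 0 < a ->
  (\int[P]_w (`|W n w|)%:E <= (a + n%:R * K ^+ 2 / a)%:E)%E.
Proof.
move=> a0; apply: (@le_trans _ _ (\int[P]_w (a%:E + a^-1%:E * (W n w ^+ 2)%:E))%E).
  apply: ge0_le_integral => //.
  - by apply/measurable_EFinP; exact: measurableT_comp.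
  - apply: emeasurable_funD => //; apply: measurable_funeM.
    by apply/measurable_EFinP; exact: measurable_funX.
  - move=> w _; rewrite -EFinM -EFinD lee_fin -real_normK ?num_real//.
    move: (`|W n w|) (normr_ge0 (W n w)) => v v0.
    have [va|av] := leP v a; first by rewrite (le_trans va)// lerDl mulr_ge0 ?sqr_ge0// invr_ge0 ltW.
    rewrite (@le_trans _ _ (a^-1 * v ^+ 2))//; last by rewrite lerDr ltW.
    by rewrite expr2 mulrA ler_peMl// mulrC ler_pdivlMr// mul1r ltW.
rewrite ge0_integralD//; last 3 first.
- by move=> w _; rewrite lee_fin ltW.
- by move=> w _; rewrite -EFinM lee_fin mulr_ge0 ?sqr_ge0// invr_ge0 ltW.
- by apply: measurable_funeM; apply/measurable_EFinP; exact: measurable_funX.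
rewrite integral_cst// [X in (_ * X)%E]probability_setT mule1 EFinD leeD2l//.
rewrite ge0_integralZl_EFin//; last 3 first.
- by move=> w _; rewrite lee_fin sqr_ge0.
- by apply/measurable_EFinP; exact: measurable_funX.
- by rewrite invr_ge0 ltW.
by rewrite mulrC EFinM lee_pmul2l ?lte_fin ?invr_gt0//; exact: truncated_variance.
Qed.

(** Truncation moves each term by at most [t] in mean, and also its expectation. *)
Lemma centred_dist (t : R) n : (tail K <= t%:E)%E ->
  (\int[P]_w (`|\sum_(i < n) tau i w - n%:R * m|)%:E <=
   (n%:R * (2 * t))%:E + \int[P]_w (`|W n w|)%:E)%E.
Proof.
move=> Kt; have t0 : 0 <= t.
  by rewrite -lee_fin (le_trans _ Kt)//; apply: integral_ge0.
have mE : (m%:E = \int[law]_x (`|x|)%:E)%E.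
  by rewrite -mean_abs -(@integral_tau (fun x => (`|x|)%:E) 0%N)//;
    apply/measurable_EFinP; exact: normr_measurable.
have ym : y <= m.
  rewrite -lee_fin -yE mE; apply: ge0_le_integral => //.
  - by move=> x _; rewrite lee_fin truncate_ge0.
  - by apply/measurable_EFinP; exact: normr_measurable.
  - move=> x _; rewrite lee_fin /truncate ge_max normr_ge0/= ge_min ler_norm orbT//.
have my : m <= t + y.
  rewrite -lee_fin EFinD -yE mE (le_trans _ (leeD2r _ Kt))// /tail -ge0_integralD//; last 2 first.
  - by apply/measurable_EFinP; exact: mtail.
  - by move=> x _; rewrite lee_fin truncate_ge0.
  apply: ge0_le_integral => //.
  - by apply/measurable_EFinP; exact: normr_measurable.
  - by apply: emeasurable_funD => //; apply/measurable_EFinP; exact: mtail.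
  - move=> x _; rewrite -EFinD lee_fin -[X in _ <= _ + X](ger0_norm (truncate_ge0 K x)).
    by rewrite -{1}(subrK (truncate K x) x) ler_normD.
have mD i : measurable_fun setT (fun w => (`|tau i w - truncate K (tau i w)|)%:E).
  by apply/measurable_EFinP; exact: (measurableT_comp (mtail K) (measurable_funP (tau i))).
have mWa : measurable_fun setT (fun w => (`|W n w|)%:E).
  by apply/measurable_EFinP; exact: measurableT_comp.
apply: (@le_trans _ _ (\int[P]_w ((\sum_(i < n) (`|tau i w - truncate K (tau i w)|)%:E) +
    ((`|W n w|)%:E + (n%:R * t)%:E)))%E).
  apply: ge0_le_integral => //.
  - apply/measurable_EFinP; apply: measurableT_comp => //; apply: measurable_funB => //.
    exact: measurable_sum.
  - apply: emeasurable_funD; first exact: emeasurable_sum.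
    exact: emeasurable_funD.
  - move=> w _; rewrite sumEFin -!EFinD lee_fin.
    have -> : \sum_(i < n) tau i w - n%:R * m =
       \sum_(i < n) (tau i w - truncate K (tau i w)) + (W n w + n%:R * (y - m)).
      rewrite addrA /W -big_split/=.
      under [in RHS]eq_bigr do rewrite addrA subrK.
      by rewrite sumrB sumr_const card_ord -mulr_natl; lra.
    rewrite (le_trans (ler_normD _ _))// lerD ?ler_norm_sum//.
    rewrite (le_trans (ler_normD _ _))// lerD// normrM ger0_norm// ler_wpM2l//.
    by rewrite ler_norml; lra.
rewrite ge0_integralD//; last 4 first.
- by move=> w _; apply: sume_ge0 => i _; rewrite lee_fin.
- exact: emeasurable_sum.
- by move=> w _; rewrite -EFinD lee_fin addr_ge0// mulr_ge0.
- exact: emeasurable_funD.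
rewrite ge0_integral_sum// ge0_integralD//; last first.
  by move=> w _; rewrite lee_fin mulr_ge0.
rewrite integral_cst// [X in (_ * X)%E]probability_setT mule1.
rewrite addeCA addeC leeD2r//.
have -> : n%:R * (2 * t) = n%:R * t + n%:R * t by lra.
rewrite EFinD leeD2r//.
apply: (@le_trans _ _ (\sum_(i < n) t%:E)%E).
  apply: lee_sum => i _; rewrite (@integral_tau (fun x => (`|x - truncate K x|)%:E))//.
  by apply/measurable_EFinP; exact: mtail.
by rewrite sumEFin sumr_const card_ord mulr_natl.
Qed.

End truncated.

(** Truncate at a level [K] where the tail contributes at most [eps / 4] per
    term.  The truncated sum deviates from its mean by at most [eps / 4] per term
    plus a quantity that does not depend on the number of terms. *)
Lemma law_of_large_numbers_L1 (eps : R) : 0 < eps -> exists n0, forall n, (n0 <= n)%N ->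
  (\int[P]_w (`|\sum_(i < n) tau i w - n%:R * m|)%:E <= (n%:R * eps)%:E)%E.
Proof.
move=> e0; have e4 : 0 < eps / 4 by lra.
have [K K0 Kt] := tail_small e4.
(* Then 4 K^2 / eps, which is (n K^2) / a for a = n eps / 4, is at most n eps / 4. *)
exists (Num.bound (16 * K ^+ 2 / eps ^+ 2)).+1 => n n0.
have nB : 16 * K ^+ 2 / eps ^+ 2 < n%:R.
  apply: lt_le_trans (archi_boundP _) _.
    by rewrite divr_ge0 ?sqr_ge0// mulr_ge0 ?sqr_ge0.
  by rewrite ler_nat ltnW.
have np : 0 < n%:R :> R by rewrite ltr0n (leq_trans _ n0).
apply: le_trans (centred_dist K0 n Kt) _.
have a0 : 0 < n%:R * eps / 4 by rewrite divr_gt0 ?mulr_gt0.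
apply: le_trans (leeD2l _ (truncated_lln K0 n a0)) _.
rewrite -EFinD lee_fin.
have -> : n%:R * K ^+ 2 / (n%:R * eps / 4) = 4 * K ^+ 2 / eps.
  by field; rewrite !gt_eqF.
suff : 4 * K ^+ 2 / eps <= n%:R * eps / 4 by lra.
rewrite ler_pdivrMr//; move: nB; rewrite ltr_pdivrMr ?exprn_gt0// => /ltW; rewrite !expr2; lra.
Qed.

End law_of_large_numbers.

(** * Time averages of convergent functions *)

(** Beyond some [t0] the function is within [eps / 2] of its limit, and what happens
    before [t0] contributes at most [t0], which is negligible for large [M]. *)
Lemma cesaro_integral (R : realType) (g : R -> \bar R) (p eps : R) :
  measurable_fun setT g -> (forall s, 0 <= g s <= 1)%E ->
  g s @[s --> +oo%R] --> p%:E -> 0 < eps ->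
  exists M0, forall M, M0 <= M ->
    (\int[lebesgue_measure]_(s in `[0%R, M[) g s <= ((p + eps) * M)%:E)%E /\
    (((p - eps) * M)%:E <= \int[lebesgue_measure]_(s in `[0%R, M[) g s)%E.
Proof.
move=> mg g01 gp e0.
have gE s : g s = (fine (g s))%:E.
  have /andP[g0 g1] := g01 s; rewrite fineK// ge0_fin_numE//.
  exact: le_lt_trans g1 (ltry _).
have f01 s : 0 <= fine (g s) <= 1.
  by have := g01 s; rewrite gE !lee_fin.
have {gp} fp : fine (g s) @[s --> +oo%R] --> p.
  exact: (fine_cvg gp).
have p01 : 0 <= p <= 1.
  apply/andP; split.
    by apply: (cvgr_to_ge fp); near=> s; case/andP: (f01 s).
  by apply: (cvgr_to_le fp); near=> s; case/andP: (f01 s).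
have /cvgrPdist_le /(_ (eps / 2)) := fp.
have e2 : 0 < eps / 2 by lra.
move=> /(_ e2) [t1 [t1r ht1]]; pose t0 := Num.max 0 (t1 + 1).
have t0_ge0 : 0 <= t0 by rewrite le_max lexx.
have ht0 s : t0 <= s -> `|p - fine (g s)| <= eps / 2.
  move=> ts; apply: ht1; apply: lt_le_trans ts.
  by rewrite lt_max; apply/orP; right; lra.
(* This is what makes t0 <= (eps / 2) * M. *)
exists (2 * t0 / eps) => M MM.
have M0 : 0 <= M.
  by apply: le_trans MM; rewrite divr_ge0 ?mulr_ge0// ltW.
have tM : t0 <= eps / 2 * M by move: MM; rewrite ler_pdivrMr//; lra.
have mD : measurable (`[0, M[%classic : set R) by [].
have lebM : lebesgue_measure (`[0, M[%classic : set R) = M%:E.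
  rewrite lebesgue_measure_itv/= lte_fin; case: ltgtP M0 => // [M0 _|<- _]; last by [].
  by rewrite -EFinD subr0.
have I0 : (\int[lebesgue_measure]_(s in `[0%R, M[) (\1_(`[0%R, t0[%classic : set R) s : R)%:E <= t0%:E)%E.
  rewrite integral_indic//.
  apply: (@le_trans _ _ (lebesgue_measure (`[0, t0[%classic : set R))).
    by apply: le_measure; rewrite ?inE//; exact: measurableI.
  rewrite lebesgue_measure_itv/= lte_fin; case: ifP => _; last by rewrite lee_fin.
  by rewrite -EFinD subr0.
have mg' : measurable_fun (`[0, M[%classic : set R) g by exact: measurable_funTS.
have mI : measurable_fun (`[0, M[%classic : set R)
    (fun s => (\1_(`[0, t0[%classic : set R) s : R)%:E).
  by apply/measurable_EFinP; apply: measurable_indic.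
have cstM (k : R) : (\int[lebesgue_measure]_(s in `[0%R, M[) k%:E = (k * M)%:E)%E.
  by rewrite integral_cst// EFinM; congr (_ * _)%E; exact: lebM.
have in0 s : 0 <= s -> s < t0 -> \1_(`[0, t0[%classic : set R) s = 1 :> R.
  by move=> s0 st; rewrite indicE mem_set//= in_itv/= s0.
split.
- apply: (@le_trans _ _ (\int[lebesgue_measure]_(s in `[0%R, M[)
      ((\1_(`[0%R, t0[%classic : set R) s : R)%:E + (p + eps / 2)%:E))%E).
    apply: ge0_le_integral => //.
    + by move=> s _; case/andP: (g01 s).
    + exact: emeasurable_funD.
    + move=> s; rewrite /= in_itv/= => /andP[s0 _].
      rewrite gE -EFinD lee_fin; have [st|ts] := ltP s t0.
        by rewrite in0//; have := f01 s; lra.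
      have := ht0 s ts; rewrite ler_norml indicE => /andP[h _].
      by have := ler0n R (s \in `[0, t0[%classic); lra.
  rewrite ge0_integralD//; last by move=> s _; rewrite lee_fin; lra.
  rewrite cstM (le_trans (leeD2r _ I0))// -EFinD lee_fin; nra.
- pose q := Num.max 0 (p - eps / 2).
  have : ((q * M)%:E <= t0%:E + \int[lebesgue_measure]_(s in `[0%R, M[) g s)%E.
    apply: le_trans (leeD2r _ I0); rewrite -cstM -ge0_integralD//; last first.
      by move=> s _; case/andP: (g01 s).
    apply: ge0_le_integral => //.
    + by move=> s _; rewrite lee_fin le_max lexx.
    + exact: emeasurable_funD.
    + move=> s; rewrite /= in_itv/= => /andP[s0 _].
      rewrite gE -EFinD lee_fin /q ge_max; have := f01 s; have [st|ts] := ltP s t0.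
        by rewrite in0// => h; apply/andP; split; lra.
      have := ht0 s ts; rewrite ler_norml indicE => /andP[h h'] h''.
      by have := ler0n R (s \in `[0, t0[%classic) => h3; apply/andP; split; lra.
  have qp : p - eps / 2 <= q by rewrite le_max lexx orbT.
  have [x ->] : exists x, (\int[lebesgue_measure]_(s in `[0%R, M[) g s = x%:E)%E.
    exists (fine (\int[lebesgue_measure]_(s in `[0%R, M[) g s)%E).
    rewrite fineK// ge0_fin_numE; last by apply: integral_ge0 => s _; case/andP: (g01 s).
    apply: (@le_lt_trans _ _ (\int[lebesgue_measure]_(s in `[0%R, M[) 1%:E)%E).
      by apply: ge0_le_integral => // s _; case/andP: (g01 s).
    by rewrite cstM ltry.
  rewrite -EFinD !lee_fin; nra.
Unshelve. all: by end_near.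
Qed.

(** * The stochastic queue *)

(** Being at [n] or above after an upward move means having crossed [n] or having
    been there before; used forwards at an arrival, and backwards in time between
    two arrivals. *)
Lemma crossing_probability (R : realType) d (T : measurableType d) (P : probability T R)
    (a l : T -> nat) n : measurable_fun setT a -> measurable_fun setT l ->
  {ae P, forall w, (a w <= l w)%N} ->
  (P [set w | (a w < n <= l w)%N] + P [set w | (n <= a w)%N] = P [set w | (n <= l w)%N])%E.
Proof.
move=> ma ml al.
have m1 : measurable_fun setT (fun w => (a w < n <= l w)%N).
  by apply: measurable_and; [apply: (measurableT_comp (f := fun x => (x < n)%N))
                            |apply: (measurableT_comp (f := fun x => (n <= x)%N))].
have m2 : measurable_fun setT (fun w => (n <= a w)%N).
  by apply: (measurableT_comp (f := fun x => (n <= x)%N)).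
have m3 : measurable_fun setT (fun w => (n <= l w)%N).
  by apply: (measurableT_comp (f := fun x => (n <= x)%N)).
have mb (b : T -> bool) : measurable_fun setT b ->
    measurable_fun setT (fun w => (b w)%:R%:E : \bar R).
  by move=> ?; apply/measurable_EFinP; exact: measurable_fun_of_bool.
rewrite !probability_bool// -ge0_integralD//; last 2 first.
- exact: mb.
- exact: mb.
apply: ge0_ae_eq_integral => //.
- by apply: emeasurable_funD; exact: mb.
- exact: mb.
- by move=> w _; rewrite -EFinD -natrD lee_fin ler0n.
apply: filterS al => w alw _; rewrite -EFinD -natrD; congr (_%:R%:E).
by case: (ltnP (a w) n) => an /=; [rewrite addn0|rewrite (leq_trans an)].
Qed.

Section queue.
Context (R : realType) d (T : measurableType d) (P : probability T R).
Variables (c N : nat) (mu : R) (q0 : {RV P >-> nat}) (s0 : nat -> {RV P >-> R})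
  (tau : nat -> {RV P >-> R}) (X : nat -> {RV P >-> nat})
  (S : nat -> nat -> {RV P >-> R}).
Hypotheses (hc : (0 < c)%N) (hmu : 0 < mu).
Hypothesis tau_ge0 : forall i, {ae P, forall w, 0 <= tau i w}.
Hypothesis hS : forall i r B, measurable B ->
    distribution P (S i r) B = exponential_prob mu B.
Hypothesis hs0 : forall r B, measurable B ->
    distribution P (s0 r) B = exponential_prob mu B.
Hypothesis hq0 : P [set w | (q0 w <= N)%N] = 1%E.
Hypothesis hindep : mutually_independent P (primitives q0 s0 tau X S).

Let F := primitives q0 s0 tau X S.

Lemma sigma_of_setI d' (T' : measurableType d') (f : T -> T') : setI_closed (sigma_of f).
Proof.
move=> _ _ [B mB <-] [B' mB' <-]; exists (B `&` B'); first exact: measurableI.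
by rewrite !setTI.
Qed.

Lemma sigma_of_setT d' (T' : measurableType d') (f : T -> T') : sigma_of f setT.
Proof. by exists setT => //; rewrite setTI. Qed.

Lemma sigma_of_measurable d' (T' : measurableType d') (f : {mfun T >-> T'}) :
  sigma_of f `<=` measurable.
Proof. by move=> _ [B mB <-]; exact: measurable_funP. Qed.

Let FI l : setI_closed (F l).
Proof. by case: l => * /=; exact: sigma_of_setI. Qed.

Let FT l : F l setT.
Proof. by case: l => * /=; exact: sigma_of_setT. Qed.

Let Fm l : F l `<=` measurable.
Proof. by case: l => * /=; exact: sigma_of_measurable. Qed.

Lemma others_measurable l : others F l `<=` measurable.
Proof. by move=> B [l' _ /Fm]. Qed.

Lemma primitive_indep l A B : F l A -> <<s others F l >> B ->
  P (A `&` B) = (P A * P B)%E.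
Proof. exact: mutually_independent_others. Qed.

(** Any primitive other than [l] is determined by the information left when [l] is
    withheld. *)
Lemma measurable_others l l' d' (T' : measurableType d') (f : T -> T') :
  F l' = sigma_of f -> l' <> l ->
  measurable_fun [set: g_sigma_algebraType (others F l)] f.
Proof.
move=> Ff ll _ B mB; apply: sub_sigma_algebra.
by exists l'; [apply/eqP|rewrite Ff; exists B].
Qed.

(** The initial customers form a batch number 0 that arrives at time 0, which
    shifts the numbering of the other batches by one. *)
Definition arrival i (w : T) : R := if i is i'.+1 then epoch tau i' w else 0.
Definition batch i : {RV P >-> nat} := if i is i'.+1 then X i' else q0.
Definition service i r : {RV P >-> R} := if i is i'.+1 then S i' r else s0 r.
Definition label i r := if i is i'.+1 then Service i' r else InitialService r.

Notation services w := (fun i r => service i r w).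
Notation qlog w := (log c N (arrival^~ w) (batch^~ w) (services w)).

Lemma epochS i w : epoch tau i.+1 w = epoch tau i w + tau i.+1 w.
Proof. by rewrite /epoch big_ord_recr. Qed.

Lemma measurable_arrival i : measurable_fun setT (arrival i).
Proof.
case: i => [|i]; first exact: measurable_cst.
by apply: measurable_sum.
Qed.

Lemma measurable_arrival_others l i : (forall i', l <> Interarrival i') ->
  measurable_fun [set: g_sigma_algebraType (others F l)] (arrival i).
Proof.
case: i => [|i] lI; first exact: measurable_cst.
apply: measurable_sum => j; apply: (@measurable_others _ (Interarrival j)) => //.
exact/nesym.
Qed.

Lemma measurable_batch_others l i : (forall i', l <> BatchSize i') -> l <> InitialSize ->
  measurable_fun [set: g_sigma_algebraType (others F l)] (batch i).
Proof.
case: i => [|i] lB lI.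
  by apply: (@measurable_others _ InitialSize) => //; exact: nesym.
by apply: (@measurable_others _ (BatchSize i)) => //; exact/nesym.
Qed.

Lemma measurable_service_others l i r : label i r <> l ->
  measurable_fun [set: g_sigma_algebraType (others F l)] (service i r).
Proof. by case: i => [|i] lS; apply: (measurable_others (l' := label _ r)) lS. Qed.

Lemma label_inj i r j k : label i r = label j k -> (i == j) && (r == k).
Proof.
by move: i j => [|i] [|j] //=; [case=> ->; rewrite eqxx|case=> -> ->; rewrite !eqxx].
Qed.

Lemma arrival_homo : {ae P, forall w, {homo arrival^~ w : i j / (i <= j)%N >-> i <= j}}.
Proof.
have h : {ae P, forall w i, 0 <= tau i w} by exact/ae_foralln.
apply: filterS h => w tw; apply: homo_leq => //; first by move=> ? ? ?; exact: le_trans.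
case=> [|i] /=; first by rewrite /epoch big_ord1.
by rewrite epochS lerDl.
Qed.

Let meG j k i : measurable_fun [set: g_sigma_algebraType (others F (label j k))] (arrival i).
Proof. by apply: measurable_arrival_others => i'; case: j. Qed.

Let mXG j k i : measurable_fun [set: g_sigma_algebraType (others F (label j k))] (batch i).
Proof. by apply: measurable_batch_others => [i'|]; case: j. Qed.

Let msvG j k i r : (i == j) && (r == k) = false ->
  measurable_fun [set: g_sigma_algebraType (others F (label j k))] (service i r).
Proof.
by move=> ij; apply: measurable_service_others => /label_inj; rewrite ij.
Qed.

Let sv_indep j k A B : measurable A -> <<s others F (label j k) >> B ->
  P (service j k @^-1` A `&` B) = (P (service j k @^-1` A) * P B)%E.
Proof.
move=> mA; apply: primitive_indep.
by case: j => [|j]; exists A => //; rewrite setTI.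
Qed.

Let sv_law j k B : measurable B ->
  distribution P (service j k) B = exponential_prob mu B.
Proof. by case: j => [|j]; [exact: hs0|exact: hS]. Qed.

Lemma queue_downcrossing n i :
  (P [set w | let D := ends (qlog w i.+1) in
       (present (arrival i.+1 w) D < n <= present (arrival i w) D)%N] =
   (mu * (minn n c)%:R)%:E * \int[P]_w lebesgue_measure
     [set s | (arrival i w <= s < arrival i.+1 w)%R /\
        present s (ends (qlog w i.+1)) = n])%E.
Proof.
apply: (@downcrossing_rate _ _ _ P c N mu arrival batch service
  (fun j k => others F (label j k))) => //.
- exact: measurable_arrival.
- by move=> j k; exact: others_measurable.
- exact: arrival_homo.
Qed.

Lemma queue_service_gt0 : {ae P, forall w i r, 0 < service i r w}.
Proof. exact: (service_gt0 sv_law). Qed.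

Lemma initial_le : {ae P, forall w, (q0 w <= N)%N}.
Proof.
have mq : measurable [set w | (q0 w <= N)%N].
  by apply: measurable_bool_set; apply: (measurable_fun_nat_op2 leq).
exists (~` [set w | (q0 w <= N)%N]); split => //; first exact: measurableC.
by rewrite probability_setC// hq0 subee.
Qed.

Lemma departuresE w n : (q0 w <= N)%N ->
  departures c N q0 s0 tau X S n w = ends (qlog w n.+1).
Proof.
move=> qN; elim: n => [|n IH].
  by rewrite logS /admitted/= qN /before ends_log_enqueue.
rewrite [LHS]/= IH [in RHS]logS /admitted /arrival -/(arrival n.+1 w).
by case: ifP => // _; rewrite /before ends_log_enqueue.
Qed.

Lemma foundE w i : (q0 w <= N)%N ->
  found c N q0 s0 tau X S i w = present (arrival i.+1 w) (ends (qlog w i.+1)).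
Proof. by move=> qN; rewrite /found departuresE. Qed.

(** At such a time the batches that have arrived are exactly those numbered below
    [i], as the arrival epochs are in order. *)
Lemma system_sizeE w i s : (q0 w <= N)%N ->
  {homo arrival^~ w : i j / (i <= j)%N >-> i <= j} ->
  arrival i w <= s < arrival i.+1 w ->
  system_size c N q0 s0 tau X S s w = present s (ends (qlog w i.+1)).
Proof.
move=> qN ew /andP[es se]; rewrite /system_size departuresE//.
suff -> : arrivals tau s w = i by [].
rewrite /arrivals; apply: card_fset_set.
rewrite (_ : [set i | _] = `I_i) ?card_eqxx//.
apply/seteqP; split => j /=; last by move=> ji; rewrite (le_trans (ew j.+1 i ji)).
rewrite leNgt; apply: contraNT; rewrite -leqNgt => ij.
by rewrite (lt_le_trans se)//; exact: (ew i.+1 j.+1).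
Qed.

(** * Crossings of a level at arrivals and between arrivals *)

Definition found_at i w := present (arrival i w) (ends (qlog w i)).
(** The number of customers just after arrival [i]. *)
Definition left_at i w := present (arrival i w) (ends (qlog w i.+1)).

Lemma measurable_present m (t : T -> R) : measurable_fun setT t ->
  measurable_fun setT (fun w => present (t w) (ends (qlog w m))).
Proof.
have h : measurable_list (fun w => ends (qlog w m)).
  by apply: (@measurable_log _ _ _ c N arrival batch service) => // i;
    exact: measurable_arrival.
by move=> mt; exact: (h t mt).2.
Qed.

Lemma found_le_left : {ae P, forall w i, (found_at i w <= left_at i w)%N}.
Proof.
apply: filterS queue_service_gt0 => w sw i.
by rewrite /left_at present_accept// leq_addr.
Qed.

Lemma found_next_le_left : {ae P, forall w i, (found_at i.+1 w <= left_at i w)%N}.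
Proof.
by apply: filterS arrival_homo => w ew i; apply: present_anti; exact: ew.
Qed.

(** Both sides are the probability of [n] or more customers just after arrival
    [i], as seen from what the arrival finds and from what the next one finds. *)
Lemma crossing_balance n i :
  (P [set w | (found_at i w < n <= left_at i w)%N] + P [set w | (n <= found_at i w)%N] =
   P [set w | (found_at i.+1 w < n <= left_at i w)%N] +
   P [set w | (n <= found_at i.+1 w)%N])%E.
Proof.
have mf j : measurable_fun setT (found_at j).
  by apply: measurable_present; exact: measurable_arrival.
have ml j : measurable_fun setT (left_at j).
  by apply: measurable_present; exact: measurable_arrival.
rewrite !crossing_probability//.
  by apply: filterS found_next_le_left => w.
by apply: filterS found_le_left => w.
Qed.

Variable b : nat -> R.
Hypothesis hX : forall i k, P [set w | X i w = k] = (b k)%:E.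

Lemma measurable_found_others i :
  measurable_fun [set: g_sigma_algebraType (others F (BatchSize i))] (found_at i.+1).
Proof.
(* Blank the size of batch i + 1: what that batch finds does not depend on it. *)
pose X' j : T -> nat := if j == i.+1 then fun=> 0%N else batch j.
have E w : qlog w i.+1 = log c N (arrival^~ w) (X'^~ w) (services w) i.+1.
  by apply: eq_log_batch => j ji; rewrite /X' (ltn_eqF ji).
rewrite (_ : found_at i.+1 = fun w => present (arrival i.+1 w)
    (ends (log c N (arrival^~ w) (X'^~ w) (services w) i.+1))); last first.
  by apply/funext => w; rewrite /found_at E.
have ma j : measurable_fun [set: g_sigma_algebraType (others F (BatchSize i))] (arrival j).
  exact: measurable_arrival_others.
suff h : measurable_list (T := g_sigma_algebraType (others F (BatchSize i)))
    (fun w => ends (log c N (arrival^~ w) (X'^~ w) (services w) i.+1)).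
  exact: (h _ (ma i.+1)).2.
apply: (@measurable_log _ (g_sigma_algebraType (others F (BatchSize i))) R c N
    arrival X' (fun j r => service j r)) => // [j|j r].
  rewrite /X'; case: eqP => // ji; case: j ji => [|j] ji.
    exact: (@measurable_others _ InitialSize).
  by apply: (@measurable_others _ (BatchSize j)) => // -[] /(congr1 succn).
by apply: measurable_service_others; case: j.
Qed.

Lemma b_ge0 k : 0 <= b k.
Proof. by rewrite -lee_fin -(hX 0%N). Qed.

Lemma batch_size_between i (l u : nat) :
  P [set w | (l <= X i w < u)%N] = (\sum_(l <= k < u) b k)%:E.
Proof.
elim: u => [|u IH].
  by rewrite big_geq// (_ : [set w | _] = set0) ?measure0//;
    apply/seteqP; split => w //=; rewrite ltn0 andbF.
have mX (p : nat -> bool) : measurable [set w | p (X i w)].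
  by apply: measurable_bool_set; exact: measurableT_comp.
have [lu|ul] := leqP l u; last first.
  rewrite big_geq// (_ : [set w | _] = set0) ?measure0//.
  apply/seteqP; split => w //= /andP[lX]; rewrite ltnS => Xu.
  by move: ul; rewrite ltnNge (leq_trans lX Xu).
rewrite big_nat_recr//= EFinD -IH -(hX i).
rewrite -measureU; last 3 first.
- exact: (mX (fun x => (l <= x < u)%N)).
- rewrite (_ : [set w | _] = [set w | X i w == u]); first exact: (mX (fun x => x == u)).
  by apply/seteqP; split => w /= /eqP.
- by apply/seteqP; split => w //= [/andP[_ +] Xu]; rewrite Xu ltnn.
congr (P _); apply/seteqP; split => w /=.
  move=> /andP[lX]; rewrite ltnS leq_eqVlt => /orP[/eqP Xu|Xu]; first by right.
  by left; rewrite lX.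
by move=> [/andP[-> Xu]|->]; [rewrite ltnS ltnW|rewrite lu ltnSn].
Qed.

(** A batch that finds [k < n] customers raises their number to [n] or more exactly
    when its size is between [n - k] and [N - k]; its size is independent of [k]. *)
Lemma upcrossing_probability n i : (n <= N)%N ->
  (P [set w | (found_at i.+1 w < n <= left_at i.+1 w)%N] =
   \sum_(k < n) P [set w | found_at i.+1 w = k] *
     (\sum_(n - k <= l < N - k + 1) b l)%:E)%E.
Proof.
move=> nN.
have mf : measurable_fun setT (found_at i.+1).
  by apply: measurable_present; exact: measurable_arrival.
have ml : measurable_fun setT (left_at i.+1).
  by apply: measurable_present; exact: measurable_arrival.
pose B (k : nat) w := (found_at i.+1 w == k) && (n - k <= X i w < N - k + 1)%N.
have mB k : measurable_fun setT (B k).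
  apply: measurable_and; first by apply: (measurableT_comp (f := fun x => x == k)).
  by apply: (measurableT_comp (f := fun x => (n - k <= x < N - k + 1)%N)).
have mBE k : measurable_fun setT (fun w => (B k w)%:R%:E : \bar R).
  by apply/measurable_EFinP; exact: measurable_fun_of_bool.
transitivity (\sum_(k < n) P [set w | B k w])%E; last first.
  apply: eq_bigr => k _; rewrite -(batch_size_between i) muleC.
  rewrite -(@primitive_indep (BatchSize i)).
  - congr (P _); apply/seteqP; split => w; rewrite /B/=.
      by move=> /andP[/eqP ? ?].
    by move=> [-> ->]; rewrite eqxx.
  - by exists [set x | (n - k <= x < N - k + 1)%N] => //; rewrite setTI.
  - have h : measurable ([set: g_sigma_algebraType (others F (BatchSize i))] `&`
        found_at i.+1 @^-1` [set (k : nat)]) by exact: measurable_found_others.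
    by rewrite setTI in h.
under eq_bigr do rewrite probability_bool//.
rewrite -ge0_integral_sum//.
rewrite probability_bool; last first.
  by apply: measurable_and; [apply: (measurableT_comp (f := fun x => (x < n)%N))
                            |apply: (measurableT_comp (f := fun x => (n <= x)%N))].
apply: ge0_ae_eq_integral => //.
- apply/measurable_EFinP; apply: measurable_fun_of_bool.
  by apply: measurable_and; [apply: (measurableT_comp (f := fun x => (x < n)%N))
                            |apply: (measurableT_comp (f := fun x => (n <= x)%N))].
- exact: emeasurable_sum.
- by move=> w _; apply: sume_ge0 => k _; rewrite lee_fin ler0n.
apply: filterS queue_service_gt0 => w sw _; rewrite sumEFin; congr (_%:E).
rewrite /left_at present_accept// /admitted -/(found_at i.+1 w) /= -natr_sum.
congr (_%:R); rewrite /B; move: (found_at i.+1 w) (X i w) => f x.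
have [fn|nf] := ltnP f n => /=.
  rewrite (bigD1 (Ordinal fn))//= eqxx/= big1 ?addn0; last first.
    by move=> k /eqP kf; case: eqP => // E; case: kf; apply: val_inj.
  by case: ifPn; lia.
by rewrite big1// => k _; case: eqP => // E; have := ltn_ord k; rewrite -E ltnNge nf.
Qed.

(** * Time spent at a level *)

Notation Q s w := (system_size c N q0 s0 tau X S s w).

Lemma measurable_queue_size :
  measurable_fun [set: R * T] (fun z => Q z.1 z.2).
Proof.
under eq_fun do rewrite -(@system_size_comp _ _ _ snd).
by apply: measurable_system_size => // *; exact: measurableT_comp.
Qed.

Lemma measurable_queue_size_time w : measurable_fun [set: R] (fun s => Q s w).
Proof.
by apply: (measurableT_comp measurable_queue_size (pair2_measurable w)).
Qed.

Lemma measurable_queue_size_at s : measurable_fun [set: T] (fun w => Q s w).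
Proof.
by apply: (measurableT_comp measurable_queue_size (pair1_measurable s)).
Qed.

Definition times_at n (u v : R) w : set R := [set s | u <= s < v /\ Q s w = n].

Lemma times_atE n u v w : times_at n u v w = `[u, v[%classic `&` [set s | Q s w == n].
Proof.
by apply/seteqP; split => s; rewrite /times_at/= in_itv/= => -[-> /eqP].
Qed.

Lemma measurable_times_at n u v w : measurable (times_at n u v w).
Proof.
rewrite times_atE; apply: measurableI => //; apply: measurable_bool_set.
by apply: (measurableT_comp (f := fun x => x == n)) => //; exact: measurable_queue_size_time.
Qed.

Lemma measurable_time_at n (u v : T -> R) : measurable_fun setT u ->
  measurable_fun setT v ->
  measurable_fun setT (fun w => lebesgue_measure (times_at n (u w) (v w) w)).
Proof.
move=> mu' mv.
have := @measurable_lebesgue_section R _ T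
  (fun z => (u z.2 <= z.1 < v z.2) && (Q z.1 z.2 == n)).
have -> : (fun w => lebesgue_measure [set s | (u w <= s < v w) && (Q s w == n)]) =
   (fun w => lebesgue_measure (times_at n (u w) (v w) w)).
  apply/funext => w; congr (lebesgue_measure _).
  by apply/seteqP; split => s /= => [/andP[? /eqP]|[-> ->]]; rewrite ?eqxx.
apply; apply: measurable_and; first apply: measurable_and.
- by apply: measurable_fun_ler => //; exact: (measurableT_comp mu').
- by apply: measurable_fun_ltr => //; exact: (measurableT_comp mv).
- by apply: (measurableT_comp (f := fun x => x == n)) => //; exact: measurable_queue_size.
Qed.

(** Tonelli's theorem exchanges the time and the expectation. *)
Lemma expected_time_at n M :
  (\int[P]_w lebesgue_measure (times_at n 0 M w) =
   \int[lebesgue_measure]_(s in `[0%R, M[) P [set w | Q s w = n])%E.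
Proof.
pose B : set (R * T) := [set z | (0 <= z.1 < M) && (Q z.1 z.2 == n)].
have mB : measurable B.
  apply: measurable_bool_set; apply: measurable_and; first apply: measurable_and.
  - exact: measurable_fun_ler.
  - exact: measurable_fun_ltr.
  - by apply: (measurableT_comp (f := fun x => x == n)) => //; exact: measurable_queue_size.
transitivity (\int[P]_w \int[lebesgue_measure]_s (\1_B (s, w))%:E)%E.
  apply: eq_integral => w _.
  transitivity (\int[lebesgue_measure]_s (\1_(ysection B w) s)%:E)%E; last first.
    by apply: eq_integral => s _; rewrite !indicE mem_ysection.
  rewrite integral_indic ?setIT//; last exact: measurable_ysection.
  congr (lebesgue_measure _); apply/seteqP; split => s; rewrite /ysection/= inE /B/=.
    by move=> [-> ->]; rewrite eqxx.
  by move=> /andP[? /eqP].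
rewrite -(@fubini_tonelli _ _ _ _ R lebesgue_measure P (fun z => (\1_B z)%:E)); last 2 first.
- exact/measurable_EFinP/measurable_indic.
- by move=> z; rewrite lee_fin.
rewrite [RHS]integral_mkcond; apply: eq_integral => s _.
transitivity (\int[P]_w (\1_(xsection B s) w)%:E)%E.
  by apply: eq_integral => w _; rewrite !indicE mem_xsection.
rewrite integral_indic ?setIT//; last exact: measurable_xsection.
rewrite patchE; case: ifPn => [|/negP]; rewrite inE/= in_itv/= => sM.
  congr (P _); apply/seteqP; split => w; rewrite /xsection/= inE /B/= sM/=.
    by move/eqP.
  by move=> ->.
rewrite (_ : xsection B s = set0) ?measure0//.
by apply/seteqP; split => w //; rewrite /xsection/= inE /B/= => /andP[].
Qed.

Lemma time_at_le n u v w :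
  (lebesgue_measure (times_at n 0 u w) <= lebesgue_measure (times_at n 0 v w) + (`|u - v|)%:E)%E.
Proof.
have L : lebesgue_measure `[v, u[%classic = (Num.max 0 (u - v))%:E.
  rewrite lebesgue_measure_itv/= lte_fin; case: ltP => uv.
    by rewrite -EFinD; congr (_%:E); rewrite (max_idPr _)// subr_ge0 ltW.
  by rewrite (max_idPl _)// subr_le0.
apply: (@le_trans _ _ (lebesgue_measure (times_at n 0 v w) + lebesgue_measure `[v, u[%classic)%E).
  apply: (@le_trans _ _ (lebesgue_measure (times_at n 0 v w `|` `[v, u[%classic))); last first.
    by apply: measureU2 => //; exact: measurable_times_at.
  apply: le_measure; rewrite ?inE; first exact: measurable_times_at.
    by apply: measurableU => //; exact: measurable_times_at.
  move=> s [/andP[s0' su] Qs]; case: (ltP s v) => sv; [left|right].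
    by split => //; rewrite s0'.
  by rewrite /= in_itv/= sv.
by rewrite L leeD2l// lee_fin ge_max normr_ge0 ler_norm.
Qed.

(** Between the arrivals [i] and [i + 1] the list of departure times does not change,
    so that the intervals between arrivals can be treated one by one. *)
Lemma occupation n m :
  (\sum_(i < m) \int[P]_w lebesgue_measure
     [set s | (arrival i w <= s < arrival i.+1 w)%R /\
        present s (ends (qlog w i.+1)) = n] =
   \int[P]_w lebesgue_measure (times_at n 0 (arrival m w) w))%E.
Proof.
have aI i : {ae P, forall w, lebesgue_measure
     [set s | (arrival i w <= s < arrival i.+1 w)%R /\
        present s (ends (qlog w i.+1)) = n] =
     lebesgue_measure (times_at n (arrival i w) (arrival i.+1 w) w)}.
  apply: filterS2 initial_le arrival_homo => w qN ew.
  congr (lebesgue_measure _); apply/seteqP; split => s /= [si E]; split => //.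
    by rewrite (system_sizeE qN ew si).
  by rewrite -(system_sizeE qN ew si).
have mwin i : measurable_fun [set: T] (fun w => lebesgue_measure
     [set s | (arrival i w <= s < arrival i.+1 w)%R /\
        present s (ends (qlog w i.+1)) = n]).
  have := measurable_lebesgue_section (@measurable_window _ _ _ P c N arrival batch
     service hc (fun i => measurable_arrival i) (fun i => measurable_funP (batch i)) n i).
  congr measurable_fun; apply/funext => w; congr (lebesgue_measure _).
  by apply/seteqP; split => s /= => [/andP[-> /eqP]//|[-> ->]]; rewrite eqxx.
have mb i : measurable_fun [set: T]
    (fun w => lebesgue_measure (times_at n (arrival i w) (arrival i.+1 w) w)).
  by apply: measurable_time_at; exact: measurable_arrival.
have mb0 i : measurable_fun [set: T]
    (fun w => lebesgue_measure (times_at n 0 (arrival i w) w)).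
  by apply: measurable_time_at => //; exact: measurable_arrival.
elim: m => [|m IH].
  rewrite big_ord0 integral0_eq// => w _.
  rewrite (_ : times_at _ _ _ _ = set0) ?measure0//.
  by apply/seteqP; split => // s [/=]; rewrite ltNge; case: (0 <= s).
rewrite big_ord_recr/= IH.
rewrite (ge0_ae_eq_integral _ (mwin m) (mb m))//; last first.
  by apply: filterS (aI m).
rewrite -ge0_integralD//; apply: ge0_ae_eq_integral => //.
- exact: emeasurable_funD.
- exact: (mb0 m.+1).
- by move=> w _; rewrite adde_ge0.
apply: filterS arrival_homo => w ew _; rewrite -measureU; last 3 first.
- exact: measurable_times_at.
- exact: measurable_times_at.
- by apply/seteqP; split => // s [[/andP[_ s1] _] [/andP[s2 _] _]]; move: (lt_le_trans s1 s2); rewrite ltxx.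
congr (lebesgue_measure _); apply/seteqP; split => s.
  move=> [[/andP[s1 s2] E]|[/andP[s1 s2] E]]; split => //.
    by rewrite s1 (lt_le_trans s2)//; exact: (ew m m.+1).
  by rewrite s2 (le_trans _ s1)//; exact: (ew 0%N m).
move=> [/andP[s1 s2] E]; case: (ltP s (arrival m w)) => sm; [left|right]; split => //.
  by rewrite s1.
by rewrite sm.
Qed.

(** * Balance of the crossings *)

Lemma left_le_capacity : {ae P, forall w i, (left_at i w <= N)%N}.
Proof.
apply: filterS2 queue_service_gt0 arrival_homo => w sw ew.
have h i : (found_at i w <= N)%N -> (left_at i w <= N)%N.
  by move=> fN; rewrite /left_at present_accept//; case: ifP => //; rewrite addn0.
elim=> [|i IH]; first exact: h.
by apply: h; apply: leq_trans IH; apply: present_anti; exact: ew.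
Qed.

(** The last batch counted by [arrivals] has arrived.  If infinitely many batches
    have arrived, none is counted and the value is the time 0 of batch 0. *)
Lemma arrival_arrivals_le t w : {homo arrival^~ w : i j / (i <= j)%N >-> i <= j} ->
  0 <= t -> arrival (arrivals tau t w) w <= t.
Proof.
move=> ew t0; case E : (arrivals tau t w) => [|j] //.
rewrite leNgt; apply/negP => tj; move: E; apply/eqP; rewrite neq_ltn; apply/orP; left.
rewrite ltnS; apply: geq_card_fset_set; apply: subset_card_le => i /= it.
rewrite ltnNge; apply/negP => ji.
have := lt_le_trans tj (ew j.+1 i.+1 ji).
by rewrite ltNge it.
Qed.

(** A batch is admitted only if it fits, and the number of customers decreases
    between arrivals. *)
Lemma system_size_le_capacity : {ae P, forall w s, 0 <= s -> (Q s w <= N)%N}.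
Proof.
have h : {ae P, forall w, {homo arrival^~ w : i j / (i <= j)%N >-> i <= j} /\ (q0 w <= N)%N}.
  by apply: filterS2 arrival_homo initial_le.
apply: filterS2 h left_le_capacity => w [ew qN] lN s s0'.
rewrite /system_size departuresE//.
apply: leq_trans (lN (arrivals tau s w)); apply: present_anti.
exact: arrival_arrivals_le.
Qed.

Lemma system_size_mass s : 0 <= s -> (\sum_(k < N.+1) P [set w | Q s w = k] = 1)%E.
Proof.
move=> s0'; have mb (k : nat) : measurable_fun setT (fun w => Q s w == k).
  by apply: (measurableT_comp (f := fun x => x == k)) => //; exact: measurable_queue_size_at.
have mbE (k : nat) : measurable_fun setT (fun w => (Q s w == k)%:R%:E : \bar R).
  by apply/measurable_EFinP; exact: measurable_fun_of_bool.
transitivity (\sum_(k < N.+1) P [set w | Q s w == k])%E.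
  by apply: eq_bigr => k _; congr (P _); apply/seteqP; split => w /= /eqP.
under eq_bigr do rewrite probability_bool//.
rewrite -ge0_integral_sum//.
transitivity (\int[P]_w (cst 1%E w))%E; last by rewrite integral_cst// mul1e; exact: probability_setT.
apply: ge0_ae_eq_integral => //.
- exact: emeasurable_sum.
- by move=> w _; apply: sume_ge0 => k _; rewrite lee_fin ler0n.
apply: filterS system_size_le_capacity => w /(_ s s0'); rewrite -ltnS => QN _.
rewrite sumEFin -natr_sum (bigD1 (Ordinal QN))//= eqxx big1 ?addn0// => k kQ.
by case: eqP => // E; move: kQ; rewrite -val_eqE /= E eqxx.
Qed.

Variable lambda : R.
Hypothesis hlambda : 0 < lambda.
Hypothesis law_tau : forall n B, measurable B ->
  distribution P (tau n) B = distribution P (tau 0%N) B.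
Hypothesis tau_mean : ('E_P[tau 0%N] = (lambda^-1)%:E)%E.

Lemma arrivalE m w : arrival m w = \sum_(i < m) tau i w.
Proof. by case: m => [|m]; rewrite ?big_ord0. Qed.

Lemma arrival_lln (eps : R) : 0 < eps -> exists n0, forall m, (n0 <= m)%N ->
  (\int[P]_w (`|arrival m w - m%:R / lambda|)%:E <= (m%:R * eps)%:E)%E.
Proof.
move=> e0.
have [] := @law_of_large_numbers_L1 _ _ _ P tau lambda^-1
  (fun n => others F (Interarrival n)) _ _ _ law_tau tau_ge0 tau_mean eps e0.
- by move=> n; exact: others_measurable.
- move=> n i /eqP ni; apply: (@measurable_others _ (Interarrival i)) => //.
  by case.
- by move=> n A B mA; apply: primitive_indep; exists A => //; rewrite setTI.
move=> n0 h; exists n0 => m nm; under eq_integral do rewrite arrivalE.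
exact: h.
Qed.

Section level.
Variables (n : nat) (p : R).
Hypotheses (n0 : (0 < n)%N) (nN : (n <= N)%N).
Hypothesis hp : P [set w | Q t w = n] @[t --> +oo%R] --> p%:E.

Let kappa := mu * (minn n c)%:R.
Let kappa_gt0 : 0 < kappa.
Proof. by rewrite mulr_gt0// ltr0n leq_min n0 hc. Qed.

Let occ i := (\int[P]_w lebesgue_measure
     [set s | (arrival i w <= s < arrival i.+1 w)%R /\
        present s (ends (qlog w i.+1)) = n])%E.

Definition mean_occupation i := fine (occ i).

Let mfound i : measurable_fun setT (found_at i).
Proof. by apply: measurable_present; exact: measurable_arrival. Qed.

Let mleft i : measurable_fun setT (left_at i).
Proof. by apply: measurable_present; exact: measurable_arrival. Qed.

Let mcross (a l : T -> nat) : measurable_fun setT a -> measurable_fun setT l ->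
  measurable [set w | (a w < n <= l w)%N].
Proof.
move=> ma ml; apply: measurable_bool_set; apply: measurable_and.
  by apply: (measurableT_comp (f := fun x => (x < n)%N)).
by apply: (measurableT_comp (f := fun x => (n <= x)%N)).
Qed.

Let down i := P [set w | (found_at i.+1 w < n <= left_at i w)%N].
Let up i := P [set w | (found_at i w < n <= left_at i w)%N].

Let downE i : (down i = kappa%:E * occ i)%E.
Proof. exact: queue_downcrossing. Qed.

(** The expectation is finite since, multiplied by [kappa], it is a probability. *)
Let occE i : occ i = (mean_occupation i)%:E.
Proof.
rewrite /mean_occupation fineK// ge0_fin_numE; last by apply: integral_ge0.
have d1 : (down i <= 1)%E by apply: probability_le1; exact: mcross.
rewrite ltey; apply/eqP => oy; move: d1; rewrite downE oy gt0_muley ?lte_fin//.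
Qed.

Lemma occupation_mean m :
  (\int[P]_w lebesgue_measure (times_at n 0 (arrival m w) w) = (series mean_occupation m)%:E)%E.
Proof.
rewrite -occupation /series/= big_mkord -sumEFin.
by apply: eq_bigr => i _; exact: occE.
Qed.

Let measurable_at : measurable_fun setT (fun s => P [set w | Q s w = n]).
Proof.
have mB : measurable [set z : R * T | Q z.1 z.2 == n].
  apply: measurable_bool_set; apply: (measurableT_comp (f := fun x => x == n)) => //.
  exact: measurable_queue_size.
rewrite (_ : (fun s => _) = P \o xsection [set z : R * T | Q z.1 z.2 == n]).
  exact: measurable_fun_xsection.
apply/funext => s /=; congr (P _); apply/seteqP.
by split => w; rewrite /xsection/= inE => /eqP.
Qed.

(** The expected time at [n] before the [m]-th arrival and before [m / lambda] differ
    by at most the mean distance between these two times. *)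
Lemma mean_occupation_cvg : arithmetic_mean mean_occupation @ \oo --> p / lambda.
Proof.
apply/cvgrPdist_le => eps e0.
(* The two errors add up to e1 / lambda + e1 = eps. *)
pose e1 := eps / (lambda^-1 + 1).
have l0 : 0 < lambda^-1 by rewrite invr_gt0.
have e10 : 0 < e1 by rewrite divr_gt0// addr_gt0.
have g01 s : (0 <= P [set w | Q s w = n] <= 1)%E.
  rewrite measure_ge0 probability_le1//; apply: measurable_nat_eq.
  exact: measurable_queue_size_at.
have [M0 hM] := cesaro_integral measurable_at g01 hp e10.
have [n1 hn1] := arrival_lln e10.
have mT k : measurable_fun setT (fun w => (`|arrival k w - k%:R / lambda|)%:E).
  apply/measurable_EFinP; apply: measurableT_comp => //.
  by apply: measurable_funB => //; exact: measurable_arrival.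
have mtime k : measurable_fun setT (fun w => lebesgue_measure (times_at n 0 (arrival k w) w)).
  by apply: measurable_time_at => //; exact: measurable_arrival.
have mtimeM M : measurable_fun setT (fun w => lebesgue_measure (times_at n 0 M w)).
  by apply: measurable_time_at.
near=> m.
have mn1 : (n1 <= m.+1)%N by apply: leqW; near: m; exact: nbhs_infty_ge.
have mM0 : M0 <= m.+1%:R / lambda.
  rewrite ler_pdivlMr// (@le_trans _ _ m%:R)//; last by rewrite ler_nat.
  by near: m; exact: nbhs_infty_ger.
set k := m.+1 in mn1 mM0 *; set M := k%:R / lambda in mM0 *.
have k0 : 0 < k%:R :> R by rewrite ltr0n.
have [J1 J2] := hM M mM0; rewrite -expected_time_at in J1 J2.
have E1 := hn1 k mn1; have I1 := occupation_mean k.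
have up1 : series mean_occupation k <= (p + e1) * M + k%:R * e1.
  rewrite -lee_fin EFinD -I1; apply: le_trans (leeD J1 E1).
  rewrite -ge0_integralD//; apply: ge0_le_integral => //.
    exact: emeasurable_funD.
  by move=> w _; exact: time_at_le.
have lo1 : (p - e1) * M <= series mean_occupation k + k%:R * e1.
  rewrite -lee_fin EFinD -I1; apply: le_trans J2 _; apply: le_trans (leeD2l _ E1).
  rewrite -ge0_integralD//; apply: ge0_le_integral => //.
    exact: emeasurable_funD.
  by move=> w _; rewrite distrC; exact: time_at_le.
have -> : arithmetic_mean mean_occupation m = series mean_occupation k / k%:R.
  by rewrite /arithmetic_mean/= mulrC.
have eE : e1 / lambda + e1 = eps by rewrite /e1; field; rewrite !gt_eqF// ltr_pwDl// ltW.
have ME x : x * M = k%:R * (x / lambda) by rewrite /M; ring.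
rewrite !ME in up1 lo1.
have up2 : series mean_occupation k / k%:R <= (p + e1) / lambda + e1.
  by rewrite ler_pdivrMr// (le_trans up1)//; lra.
have lo2 : (p - e1) / lambda - e1 <= series mean_occupation k / k%:R.
  by rewrite ler_pdivlMr//; lra.
rewrite ler_norml; apply/andP; split; lra.
Unshelve. all: by end_near.
Qed.

Variable pi : nat -> R.
Hypothesis hpi : forall k, (k <= N)%N ->
  P [set w | found c N q0 s0 tau X S i w = k] @[i --> \oo] --> (pi k)%:E.

Let found_atE i k : P [set w | found_at i.+1 w = k] =
  P [set w | found c N q0 s0 tau X S i w = k].
Proof.
have mf : measurable_fun setT (found c N q0 s0 tau X S i).
  have h := @measurable_departures _ T R c N q0 (fun r => s0 r) (fun j => tau j)
    (fun j => X j) (fun j r => S j r) hc _ _ _ _ _ i.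
  by apply: (h _ _ _ _ _ (epoch tau i) (measurable_arrival i.+1)).2.
have E (f : T -> nat) : [set w | f w = k] = [set w | f w == k].
  by apply/seteqP; split => w /= /eqP.
have me (f : T -> nat) : measurable_fun setT f -> measurable_fun setT (fun w => f w == k).
  by move=> ?; apply: (measurableT_comp (f := fun x => x == k)).
have mE (f : T -> nat) : measurable_fun setT f ->
    measurable_fun setT (fun w => (f w == k)%:R%:E : \bar R).
  by move=> /me ?; apply/measurable_EFinP; exact: measurable_fun_of_bool.
rewrite !E !probability_bool; try exact: me.
apply: ge0_ae_eq_integral => //; try exact: mE.
by apply: filterS initial_le => w qN _; rewrite (foundE _ qN).
Qed.

Let Lambda := \sum_(k < n) pi k * \sum_(n - k <= l < N - k + 1) b l.

Let up_cvg : fine \o up @ \oo --> Lambda.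
Proof.
rewrite -cvg_shiftS/=.
rewrite (_ : (fun i => _) = fun i => \sum_(k < n)
    fine (P [set w | found c N q0 s0 tau X S i w = k]) * \sum_(n - k <= l < N - k + 1) b l).
  apply: cvg_big => [|k _]; first exact: add_continuous.
  apply: cvgMl.
  by apply: fine_cvg; apply: hpi; rewrite (leq_trans _ nN)// ltnW.
apply/funext => i /=; rewrite /up upcrossing_probability//.
have fk (k : nat) : P [set w | found_at i.+1 w = k] \is a fin_num.
  by rewrite fin_num_measure//; exact: measurable_nat_eq.
rewrite -[RHS]/(fine (_%:E)) -sumEFin; congr fine; apply: eq_bigr => k _.
by rewrite EFinM -found_atE fineK.
Qed.

Let reach i := fine (P [set w | (n <= found_at i w)%N]).

Let down_fine i : fine (down i) = kappa * mean_occupation i.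
Proof. by rewrite downE occE. Qed.

Let reach01 i : 0 <= reach i <= 1.
Proof.
have m : measurable [set w | (n <= found_at i w)%N].
  by apply: measurable_bool_set; apply: (measurableT_comp (f := fun x => (n <= x)%N)).
rewrite /reach fine_ge0//= -lee_fin fineK ?fin_num_measure//; exact: probability_le1.
Qed.

Let balance i : fine (up i) + reach i = kappa * mean_occupation i + reach i.+1.
Proof.
have m j : measurable [set w | (n <= found_at j w)%N].
  by apply: measurable_bool_set; apply: (measurableT_comp (f := fun x => (n <= x)%N)).
have mu' : measurable [set w | (found_at i w < n <= left_at i w)%N] by exact: mcross.
have md : measurable [set w | (found_at i.+1 w < n <= left_at i w)%N] by exact: mcross.
rewrite -down_fine /reach -!fineD ?fin_num_measure//.
by rewrite /up crossing_balance.
Qed.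

Let series_balance m : series (fine \o up) m =
  kappa * series mean_occupation m + (reach m - reach 0).
Proof.
elim: m => [|m IH]; first by rewrite /series/= !big_geq// mulr0 subrr addr0.
rewrite !seriesSr IH mulrDr /=; have := balance m; lra.
Qed.

(** The means over the first [m] arrivals of the probabilities of an upcrossing and
    of a downcrossing differ by at most [1 / m], as [crossing_balance] telescopes. *)
Lemma level_balance : p = lambda * Lambda / ((minn n c)%:R * mu).
Proof.
have h1 := cesaro up_cvg.
have h2 : arithmetic_mean (fine \o up) @ \oo --> kappa * (p / lambda) + 0.
  rewrite (_ : arithmetic_mean _ = (fun m => kappa * arithmetic_mean mean_occupation m +
      m.+1%:R^-1 * (reach m.+1 - reach 0))); last first.
    apply/funext => m; rewrite /arithmetic_mean/= series_balance; ring.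
  apply: cvgD; first by apply: cvgMr; exact: mean_occupation_cvg.
  apply/cvgrPdist_le => eps e0; near=> m.
  have r1 := reach01 m.+1; have r2 := reach01 0%N.
  rewrite sub0r normrN normrM (@le_trans _ _ (m.+1%:R^-1 * 1))//.
    rewrite ger0_norm// ler_wpM2l//; rewrite ler_norml; apply/andP; split; lra.
  rewrite mulr1 -[leRHS]invrK lef_pV2 ?posrE ?invr_gt0//.
  rewrite (@le_trans _ _ m%:R)// ?ler_nat//.
  by near: m; exact: nbhs_infty_ger.
have := cvg_unique _ h1 h2; rewrite addr0 => ->.
rewrite /kappa; field.
have := kappa_gt0; rewrite /kappa => /lt0r_neq0; rewrite mulf_eq0 negb_or => /andP[-> ->].
by rewrite gt_eqF.
Unshelve. all: by end_near.
Qed.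

End level.

End queue.

(** * The theorem *)

(** Being negative means being at most [- 1 / k] for some [k]. *)
Lemma cdf_ae_ge0 (R : realType) d (T : measurableType d) (P : probability T R)
    (Y : {RV P >-> R}) : (forall t, t < 0 -> cdf Y t = 0%E) -> {ae P, forall w, 0 <= Y w}.
Proof.
move=> Y0.
have : P.-negligible (\bigcup_k (Y @^-1` `]-oo, - k.+1%:R^-1])).
  apply: negligible_bigcup => k; apply/negligibleP; first exact: measurable_funPTI.
  by apply: (Y0 (- k.+1%:R^-1)); rewrite oppr_lt0 invr_gt0.
apply: negligibleS => w /= /negP; rewrite -ltNge => Yw.
have [k /=] := ltr_add_invr Yw; rewrite -ltrBDr sub0r => Yk.
by exists k => //=; rewrite in_itv/= ltW// ltrNr.
Qed.

Lemma batch_tail_sub (R : realType) (b : nat -> R) (B : R) m m' :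
  (forall k, 0 <= b k) -> (forall M, \sum_(0 <= k < M) b k <= B) -> (m <= m')%N ->
  batch_tail b m - batch_tail b m' = \sum_(m <= k < m') b k.
Proof.
move=> b0 bB mm'.
have cv l : cvgn (fun M => \sum_(l <= i < M) b i).
  apply: nondecreasing_is_cvgn.
    move=> u v uv; have [lu|/ltnW ul] := leqP l u.
      by rewrite (big_cat_nat lu uv)/= lerDl sumr_ge0.
    by rewrite big_geq// sumr_ge0.
  exists B => _ [M _ <-]; apply: le_trans (bB M).
  have [lM|/ltnW Ml] := leqP l M; last by rewrite big_geq// sumr_ge0.
  by rewrite (big_cat_nat (leq0n l) lM)/= lerDr sumr_ge0.
apply/eqP; rewrite subr_eq; apply/eqP; rewrite /batch_tail.
apply/cvg_lim => //.
have : (fun M => \sum_(m <= k < m') b k + \sum_(m' <= i < M) b i) @ \oo -->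
    \sum_(m <= k < m') b k + limn (fun M => \sum_(m' <= i < M) b i).
  by apply: cvgD; [exact: cvg_cst|exact: cv].
apply: cvg_trans; apply: near_eq_cvg; near=> M.
rewrite -big_cat_nat//=; near: M; exact: nbhs_infty_ge.
Unshelve. all: by end_near.
Qed.

Theorem lemma3p6 (R : realType) (d : measure_display) (T : measurableType d)
  (P : probability T R)
  (c N : nat) (lambda mu : R) (A : R -> R) (b : nat -> R)
  (q0 : {RV P >-> nat}) (s0 : nat -> {RV P >-> R})
  (tau : nat -> {RV P >-> R}) (X : nat -> {RV P >-> nat})
  (S : nat -> nat -> {RV P >-> R})
  (pi p : nat -> R)
  (hc : (1 <= c)%N) (hN : (c <= N)%N)
  (hlambda : 0 < lambda) (hmu : 0 < mu)
  (htau : forall i t, cdf (tau i) t = (A t)%:E)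
  (hA : forall t, t < 0 -> A t = 0)
  (htau_mean : forall i, ('E_P[tau i] = (lambda^-1)%:E)%E)
  (hX : forall i k, P [set w | X i w = k] = (b k)%:E)
  (hb : b 0%N = 0)
  (hS : forall i r B, measurable B ->
    distribution P (S i r) B = exponential_prob mu B)
  (hs0 : forall r B, measurable B ->
    distribution P (s0 r) B = exponential_prob mu B)
  (hq0 : P [set w | (q0 w <= N)%N] = 1%E)
  (hindep : mutually_independent P (primitives q0 s0 tau X S))
  (hpi : forall k, (k <= N)%N ->
    P [set w | found c N q0 s0 tau X S i w = k] @[i --> \oo] --> (pi k)%:E)
  (hp : forall n, (n <= N)%N ->
    P [set w | system_size c N q0 s0 tau X S t w = n] @[t --> +oo%R]
      --> (p n)%:E) :
  (forall n, (1 <= n <= N)%N ->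
    p n = lambda * (\sum_(0 <= k < n)
              pi k * (batch_tail b (n - k) - batch_tail b (N - k + 1)))
          / ((minn n c)%:R * mu))
  /\ p 0%N = 1 - \sum_(1 <= k < N.+1) p k.
Proof.
have tau_ge0 i : {ae P, forall w, 0 <= tau i w}.
  by apply: cdf_ae_ge0 => t t0; rewrite htau hA.
have law_tau i B : measurable B ->
    distribution P (tau i) B = distribution P (tau 0%N) B.
  by apply: eq_cdf_distribution => t; rewrite !htau.
split=> [n /andP[n0 nN]|].
  have b0 := b_ge0 hX.
  have bB M : \sum_(0 <= k < M) b k <= 1.
    rewrite -lee_fin -(batch_size_between hX 0%N) probability_le1//.
    apply: measurable_bool_set.
    by apply: (measurableT_comp (f := fun x => (0 <= x < M)%N)).
  rewrite (level_balance hc hmu tau_ge0 hS hs0 hq0 hindep hX hlambda law_tau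
    (htau_mean 0%N) n0 nN (hp n nN) hpi).
  rewrite big_mkord; congr (_ * _ / _); apply: eq_bigr => k _; congr (_ * _).
  by rewrite (batch_tail_sub b0 bB)//; lia.
suff : \sum_(0 <= k < N.+1) p k = 1 by rewrite big_ltn//; lra.
(* The probabilities of 0, ..., N add up to 1 at every time t >= 0. *)
have h : (\sum_(0 <= k < N.+1) P [set w | system_size c N q0 s0 tau X S t w = k])%E
    @[t --> +oo%R] --> (\sum_(0 <= k < N.+1) (p k)%:E)%E.
  rewrite big_nat_cond; under eq_fun do rewrite big_nat_cond.
  apply: cvg_nnesum => [k _|k /andP[/andP[_ kN] _]]; first by near=> t.
  exact: hp.
have h1 : (\sum_(0 <= k < N.+1) P [set w | system_size c N q0 s0 tau X S t w = k])%E
    @[t --> +oo%R] --> 1%E.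
  apply: cvg_near_cst; near=> t; rewrite big_mkord.
  apply: (system_size_mass X hc tau_ge0 hS hs0 hq0).
  by near: t; exact: nbhs_pinfty_ge.
have E : (\sum_(0 <= k < N.+1) (p k)%:E = 1)%E := cvg_unique (@ereal_hausdorff R) h h1.
by apply: EFin_inj; rewrite -sumEFin; exact: E.
Unshelve. all: by end_near.
Qed.
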